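(* Let $T>0$ and $u_0\in L_0^2(\mathbb{T}^2)$. Then there exists $u_1\in L_0^2(\mathbb{T}^2)$ for which there is no $h\in L^2((0,T);L_0^2(\mathbb{T}^2))$ such that the solution $u$ of $$\partial_t u+\partial_x^3u+\partial_x^{-1}\partial_y^2u=\mathcal{K}h,\qquad u|_{t=0}=u_0,$$ on $(0,T)\times\mathbb{T}^2$ satisfies $u(T)=u_1$.
   Context: $\mathbb{T}=\mathbb{R}/(2\pi\mathbb{Z})$, with points of $\mathbb{T}^2$ written $(x,y)$. $L_0^2(\mathbb{T}^2)$ is the closed subspace of $v\in L^2(\mathbb{T}^2)$ whose Fourier coefficients satisfy $\widehat v(0,l)=0$ for all $l\in\mathbb{Z}$. On distributions $v$ with $\widehat v(0,l)=0$ for all $l$, $\partial_x^{-1}$ is the Fourier multiplier $\widehat{\partial_x^{-1}v}(k,l)=\frac{1}{ik}\widehat v(k,l)$, $k\neq0$. The control region is a horizontal strip $\omega=\mathbb{T}\times(a,b)$, with $(a,b)$ an open interval of $\mathbb{T}$ of length $0<b-a<2\pi$. A non-negative real-valued function $g\in C^2(\mathbb{T})$ is fixed with $\{y\in\mathbb{T}:g(y)>0\}=(a,b)$ and $\int_{\mathbb{T}}g=1$, and $$\mathcal{K}h(x,y):=g(y)\Big(h(x,y)-\int_{\mathbb{T}}g(y')h(x,y')\,dy'\Big),$$ applied at each time $t$. (Then $\mathcal{K}h$ has zero mean in $x$ whenever $h$ does.) The solution is the mild solution $u\in C([0,T];L_0^2(\mathbb{T}^2))$, given by Duhamel's formula with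 the unitary group on $L_0^2(\mathbb{T}^2)$ generated by $-(\partial_x^3+\partial_x^{-1}\partial_y^2)$. *)

(* Defs.v *)
From HB Require Import structures.
From mathcomp Require Import all_boot all_order all_algebra.
From mathcomp Require Import all_classical all_reals all_analysis.
From mathcomp.real_closed Require Import complex.

Set Implicit Arguments.
Unset Strict Implicit.
Unset Printing Implicit Defensive.

Import Order.TTheory GRing.Theory Num.Theory.
Import numFieldNormedType.Exports.

Local Open Scope classical_set_scope.
Local Open Scope ring_scope.
Local Open Scope complex_scope.

(* Functions on the torus T^2 are represented by functions R * R -> R[i], of
   which only the values on the fundamental square [0, 2pi[^2 matter. Elements
   of L^2(T^2) are compared almost everywhere on that square (eq_T2). *)
Definition T1 (R : realType) : set R := `[0, 2 * pi[.
Definition T2 (R : realType) : set (R * R) := @T1 R `*` @T1 R.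

Notation leb1 R := (@lebesgue_measure R).
Notation leb2 R := (leb1 R \x leb1 R)%E.

Definition cexp (R : realType) (z : R[i]) : R[i] :=
  (expR (complex.Re z))%:C *
  (cos (complex.Im z) +i* sin (complex.Im z)).

Definition cmeasurable (R : realType) (d : measure_display)
    (X : measurableType d) (D : set X) (f : X -> R[i]) : Prop :=
  measurable_fun D (fun x => complex.Re (f x)) /\
  measurable_fun D (fun x => complex.Im (f x)).

Definition cintegrable (R : realType) (d : measure_display)
    (X : measurableType d) (m : {measure set X -> \bar R})
    (D : set X) (f : X -> R[i]) : Prop :=
  m.-integrable D (fun x => (complex.Re (f x))%:E) /\
  m.-integrable D (fun x => (complex.Im (f x))%:E).

Definition cintegral (R : realType) (d : measure_display)
    (X : measurableType d) (m : {measure set X -> \bar R})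
    (D : set X) (f : X -> R[i]) : R[i] :=
  Rintegral m D (fun x => complex.Re (f x)) +i*
  Rintegral m D (fun x => complex.Im (f x)).

Definition sqnorm_T2 (R : realType) (v : R * R -> R[i]) : \bar R :=
  (\int[leb2 R]_(p in @T2 R) (Normc.normc (v p) ^+ 2)%:E)%E.

Definition norm_T2 (R : realType) (v : R * R -> R[i]) : R :=
  Num.sqrt (fine (sqnorm_T2 v)).

Definition inner_T2 (R : realType) (v w : R * R -> R[i]) : R[i] :=
  cintegral (leb2 R) (@T2 R) (fun p => v p * conjc (w p)).

Definition eq_T2 (R : realType) (v w : R * R -> R[i]) : Prop :=
  {ae leb2 R, forall p, @T2 R p -> v p = w p}.

Definition L2_T2 (R : realType) (v : R * R -> R[i]) : Prop :=
  cmeasurable (@T2 R) v /\ (sqnorm_T2 v < +oo)%E.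

Definition fourier (R : realType) (v : R * R -> R[i]) (k l : int) : R[i] :=
  (((2 * pi) ^+ 2)^-1)%:C *
  cintegral (leb2 R) (@T2 R)
    (fun p => v p * cexp (- ('i%C * (k%:~R * p.1%:C + l%:~R * p.2%:C)))).

Definition L20 (R : realType) (v : R * R -> R[i]) : Prop :=
  L2_T2 v /\ forall l : int, fourier v 0 l = 0.

(* Fourier symbol of - (dx^3 + dx^{-1} dy^2); for k = 0 the value is
   irrelevant, since the symbol only acts on L20. *)
Definition kp_symbol (R : realType) (k l : int) : R[i] :=
  - (('i%C * k%:~R) ^+ 3 + ('i%C * k%:~R)^-1 * ('i%C * l%:~R) ^+ 2).

(* [kp_group t v w] : w is the image of v : L20 under the time-t map of the
   unitary group generated by - (dx^3 + dx^{-1} dy^2). A relation, because w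
   is only determined almost everywhere. *)
Definition kp_group (R : realType) (t : R) (v w : R * R -> R[i]) : Prop :=
  L20 w /\
  forall k l : int, fourier w k l = cexp (t%:C * kp_symbol R k l) * fourier v k l.

Definition control_op (R : realType) (g : R -> R) (v : R * R -> R[i])
    : R * R -> R[i] :=
  fun p => (g p.2)%:C *
    (v p - cintegral (leb1 R) (@T1 R) (fun y' => (g y')%:C * v (p.1, y'))).

(* L^2((0,T); L20), through jointly measurable representatives on
   (0,T) x T^2. *)
Definition L2_time_L20 (R : realType) (T : R) (h : R -> R * R -> R[i])
    : Prop :=
  [/\ cmeasurable (`]0, T[%classic `*` @T2 R)
        (fun z : R * (R * R) => h z.1 z.2),
      {ae leb1 R, forall t, `]0, T[%classic t -> L20 (h t)} &
      (\int[leb1 R]_(t in `]0%R, T[) sqnorm_T2 (h t) < +oo)%E].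

Definition C_time_L20 (R : realType) (T : R) (u : R -> R * R -> R[i])
    : Prop :=
  (forall t, `[0, T]%classic t -> L20 (u t)) /\
  (forall t, `[0, T]%classic t ->
     norm_T2 (u s \- u t) @[s --> within `[0, T]%classic (nbhs t)] --> (0 : R)).

(* [L2_integral A F w] : w is the L^2(T^2)-valued integral of F over A, in the
   weak (Pettis) sense, i.e. tested against every element of L^2(T^2); it is
   the Bochner integral when the latter exists. *)
Definition L2_integral (R : realType) (A : set R) (F : R -> R * R -> R[i])
    (w : R * R -> R[i]) : Prop :=
  L2_T2 w /\
  forall phi, L2_T2 phi ->
    cintegrable (leb1 R) A (fun s => inner_T2 (F s) phi) /\
    inner_T2 w phi = cintegral (leb1 R) A (fun s => inner_T2 (F s) phi).

(* Mild solution on [0, T] of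
     d_t u + dx^3 u + dx^{-1} dy^2 u = f,  u(0) = u0 :
   v is the free evolution S(t) u0 and F s = S(t - s) (f s). *)
Definition mild_solution (R : realType) (T : R) (u0 : R * R -> R[i])
    (f u : R -> R * R -> R[i]) : Prop :=
  C_time_L20 T u /\
  forall t, `[0, T]%classic t ->
    exists v w F,
      [/\ kp_group t u0 v,
          {ae leb1 R, forall s, `]0, t[%classic s ->
             kp_group (t - s) (f s) (F s)},
          L2_integral `]0, t[%classic F w &
          eq_T2 (u t) (v \+ w)].

(* g is a C^2 function on R / (2 pi Z) *)
Definition C2_periodic (R : realType) (g : R -> R) : Prop :=
  [/\ forall y, g (y + 2 * pi) = g y,
      forall y, derivable g y 1,
      forall y, derivable (derive1 g) y 1 &
      continuous (derive1n 2 g)].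

(* Main.v *)
Require Import Defs.
From mathcomp Require Import all_boot all_order all_algebra.
From mathcomp Require Import all_classical all_reals all_analysis.
From mathcomp Require Import measurable_realfun.
From mathcomp Require Import ring lra zify.
From mathcomp.real_closed Require Import complex.

(** The obstruction is that waves of high frequency in x hardly move in y.
    The free flow multiplies the mode [e^{i(kx + ly)}] by
    [e^{it(k^3 - l^2/k)}]: up to a phase that depends on k only, the component
    of x-frequency k follows a Schroedinger equation in y during the short
    time [T/k]. A profile in y built from a few frequencies and concentrated
    away from the strip is therefore almost frozen when k is large; it barely
    meets the support of g during [[0, T]], and the control barely acts on it.

    Let c be the middle of the complement of (a, b). The test functions are
    [e^{-ikx} ((1 + cos (y - c)) / 2)^N]. The binomial formula writes the
    profile as a trigonometric polynomial with nonnegative weights of sum 1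
    and frequencies at most N ([bin_weight_cis]). On the strip the profile is
    at most [q^N] for some q < 1 ([outside_strip]), and the flow during a time
    at most T displaces it by at most [T N^2 / k] ([evolved_test_le]).
    Pairing Duhamel's formula with a test function moves the group onto the
    test function, so that everything reachable from [u0] with the control h
    satisfies
      [|<u(T) - S(T) u0, test>| <= M (q^N + T N^2 / k) C(h)]
    with [C(h)] independent of k and N ([control_op_bound],
    [control_test_le]). As the test functions are trigonometric polynomials,
    each pairing is a finite combination of Fourier coefficients, and those
    are what the group is defined by.

    The unreachable state is [S(T) u0 + f], where
    [f = sum_m 2^{-m} e^{i 64^m x}] does not depend on y and has Fourier
    coefficients that decay slowly along the frequencies [64^m]. Its pairing
    with the test function of x-frequency [k = 64^m] is [4 pi^2 2^{-m}] times
    the central binomial weight, hence at least [4 pi^2 2^{-m} / (2N + 1)]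
    ([bin_weight_mid]). If [S(T) u0 + f] were reached, this would be at most
    [M (q^N + T N^2 / 64^m) C(h)] for all m and N ([reachable_lacunary_le]),
    which fails for N a large multiple of m and m large
    ([lacunary_contradiction]). *)

Import Order.TTheory GRing.Theory Num.Theory.
Import numFieldNormedType.Exports.
Local Open Scope classical_set_scope.
Local Open Scope ring_scope.

Set Implicit Arguments.
Unset Strict Implicit.
Unset Printing Implicit Defensive.
Local Open Scope complex_scope.

(** * Complex-valued integrals *)

Lemma Re_mulc (R : realType) (c z : R[i]) :
  complex.Re (c * z) =
  complex.Re c * complex.Re z - complex.Im c * complex.Im z.
Proof. by case: c; case: z. Qed.

Lemma Im_mulc (R : realType) (c z : R[i]) :
  complex.Im (c * z) =
  complex.Re c * complex.Im z + complex.Im c * complex.Re z.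
Proof. by case: c; case: z. Qed.

Lemma Re_addc (R : realType) (c z : R[i]) :
  complex.Re (c + z) = complex.Re c + complex.Re z.
Proof. by case: c; case: z. Qed.

Lemma Im_addc (R : realType) (c z : R[i]) :
  complex.Im (c + z) = complex.Im c + complex.Im z.
Proof. by case: c; case: z. Qed.

Lemma Re_oppc (R : realType) (z : R[i]) : complex.Re (- z) = - complex.Re z.
Proof. by case: z. Qed.

Lemma Im_oppc (R : realType) (z : R[i]) : complex.Im (- z) = - complex.Im z.
Proof. by case: z. Qed.

Lemma eqc_ReIm (R : realType) (z w : R[i]) :
  complex.Re z = complex.Re w -> complex.Im z = complex.Im w -> z = w.
Proof. by case: z => ? ?; case: w => ? ? /= -> ->. Qed.

Section ComplexIntegral.
Context d (X : measurableType d) (R : realType).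
Variables (m : {measure set X -> \bar R}) (D : set X).
Hypothesis mD : measurable D.
Implicit Types f g : X -> R[i].

Let intD (f g : X -> R) : m.-integrable D (EFin \o f) ->
  m.-integrable D (EFin \o g) -> m.-integrable D (EFin \o (fun x => f x + g x)).
Proof. by move=> mf mg; exact: (integrableD mD mf mg). Qed.

Let intB (f g : X -> R) : m.-integrable D (EFin \o f) ->
  m.-integrable D (EFin \o g) -> m.-integrable D (EFin \o (fun x => f x - g x)).
Proof. by move=> mf mg; exact: (integrableB mD mf mg). Qed.

Let intZ (c : R) (f : X -> R) : m.-integrable D (EFin \o f) ->
  m.-integrable D (EFin \o (fun x => c * f x)).
Proof. by move=> mf; exact: (integrableZl mD c mf). Qed.

Lemma cintegrable0 : cintegrable m D (fun=> 0).
Proof. by split; exact: integrable0. Qed.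

Lemma cintegral0 : cintegral m D (fun=> 0) = 0.
Proof.
by rewrite /cintegral /Rintegral; under eq_integral do rewrite /=;
   rewrite integral0.
Qed.

Lemma cintegrableD f g : cintegrable m D f -> cintegrable m D g ->
  cintegrable m D (fun x => f x + g x).
Proof.
move=> [f1 f2] [g1 g2]; split.
- by under eq_fun do rewrite Re_addc; exact: intD.
- by under eq_fun do rewrite Im_addc; exact: intD.
Qed.

Lemma cintegralD f g : cintegrable m D f -> cintegrable m D g ->
  cintegral m D (fun x => f x + g x) = cintegral m D f + cintegral m D g.
Proof.
move=> [f1 f2] [g1 g2]; apply: eqc_ReIm => /=.
- by under eq_Rintegral do rewrite Re_addc; rewrite RintegralD.
- by under eq_Rintegral do rewrite Im_addc; rewrite RintegralD.
Qed.

Lemma cintegrableZ c f : cintegrable m D f -> cintegrable m D (fun x => c * f x).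
Proof.
move=> [f1 f2]; split.
- under eq_fun do rewrite Re_mulc.
  by apply: intB; exact: intZ.
- under eq_fun do rewrite Im_mulc.
  by apply: intD; exact: intZ.
Qed.

Lemma cintegralZ c f : cintegrable m D f ->
  cintegral m D (fun x => c * f x) = c * cintegral m D f.
Proof.
move=> [f1 f2]; apply: eqc_ReIm; rewrite ?Re_mulc ?Im_mulc /=.
- under eq_Rintegral do rewrite Re_mulc.
  by rewrite RintegralB ?RintegralZl//; exact: intZ.
- under eq_Rintegral do rewrite Im_mulc.
  by rewrite RintegralD ?RintegralZl//; exact: intZ.
Qed.

Lemma cintegrable_sum n (F : 'I_n -> X -> R[i]) :
  (forall j, cintegrable m D (F j)) ->
  cintegrable m D (fun x => \sum_(j < n) F j x).
Proof.
move=> mF; elim: n F mF => [|n IH] F mF.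
  by under [X in cintegrable _ _ X]eq_fun do rewrite big_ord0; exact: cintegrable0.
under [X in cintegrable _ _ X]eq_fun do rewrite big_ord_recl.
by apply: cintegrableD => //; apply: IH.
Qed.

Lemma cintegral_sum n (F : 'I_n -> X -> R[i]) :
  (forall j, cintegrable m D (F j)) ->
  cintegral m D (fun x => \sum_(j < n) F j x) =
  \sum_(j < n) cintegral m D (F j).
Proof.
move=> mF; elim: n F mF => [|n IH] F mF.
  rewrite big_ord0.
  by under [X in cintegral _ _ X]eq_fun do rewrite big_ord0; exact: cintegral0.
rewrite big_ord_recl.
under [X in cintegral _ _ X]eq_fun do rewrite big_ord_recl.
rewrite cintegralD// ?IH//.
by apply: cintegrable_sum.
Qed.

Lemma eq_cintegral f g : (forall x, D x -> f x = g x) ->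
  cintegral m D f = cintegral m D g.
Proof.
by move=> fg; apply: eqc_ReIm => /=; apply: eq_Rintegral => x /[!inE] Dx;
   rewrite fg.
Qed.

Lemma eq_cintegrable f g : (forall x, D x -> f x = g x) ->
  cintegrable m D f -> cintegrable m D g.
Proof.
move=> fg [f1 f2]; split; [move: f1|move: f2];
  by apply: eq_integrable => // x /[!inE] Dx; rewrite fg.
Qed.

Lemma ae_eq_cintegral f g : cintegrable m D f -> cintegrable m D g ->
  {ae m, forall x, D x -> f x = g x} -> cintegral m D f = cintegral m D g.
Proof.
move=> [f1 f2] [g1 g2] fg; apply: eqc_ReIm => /=; congr fine;
  apply: ae_eq_integral => //.
- exact: measurable_int f1.
- exact: measurable_int g1.
- by apply: filterS fg => x /[apply] ->.
- exact: measurable_int f2.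
- exact: measurable_int g2.
- by apply: filterS fg => x /[apply] ->.
Qed.

Let integrable_bounded_mul (f g : X -> R) M :
  m.-integrable D (EFin \o f) -> measurable_fun D g ->
  (forall x, D x -> `|g x| <= M) -> m.-integrable D (EFin \o (fun x => f x * g x)).
Proof.
move=> If mg gM.
have mf : measurable_fun D f by apply/measurable_EFinP; exact: measurable_int If.
apply: (le_integrable mD _ _ (intZ M If)).
  by apply/measurable_EFinP; exact: measurable_funM.
move=> x Dx /=; rewrite lee_fin !normrM mulrC ler_wpM2r//.
by rewrite (le_trans (gM x Dx))// ler_norm.
Qed.

Lemma cintegrable_bounded_mul f g M : cintegrable m D f -> cmeasurable D g ->
  (forall x, D x -> `|complex.Re (g x)| <= M /\ `|complex.Im (g x)| <= M) ->
  cintegrable m D (fun x => f x * g x).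
Proof.
move=> [f1 f2] [g1 g2] gM; split.
- under eq_fun do rewrite Re_mulc.
  by apply: intB; apply: (@integrable_bounded_mul _ _ M) => // x /gM[].
- under eq_fun do rewrite Im_mulc.
  by apply: intD; apply: (@integrable_bounded_mul _ _ M) => // x /gM[].
Qed.

End ComplexIntegral.

(** * Unimodular exponentials and binomial profiles *)

Definition cis (R : realType) (t : R) : R[i] := cos t +i* sin t.

Lemma cisD (R : realType) (a b : R) : cis (a + b) = cis a * cis b.
Proof. by rewrite /cis cosD sinD; apply: eqc_ReIm; rewrite //= addrC. Qed.

Lemma cis0 (R : realType) : cis (0 : R) = 1.
Proof. by rewrite /cis cos0 sin0. Qed.

Lemma cisMn (R : realType) (n : nat) (t : R) : cis (n%:R * t) = cis t ^+ n.
Proof.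
elim: n => [|n IH]; first by rewrite mul0r expr0 cis0.
by rewrite exprS -IH -cisD -addn1 natrD mulrDl mul1r addrC.
Qed.

Lemma cisN_mul (R : realType) (t : R) : cis (- t) * cis t = 1.
Proof. by rewrite -cisD addNr cis0. Qed.

Lemma cexp_imag (R : realType) (t : R) : cexp ('i%C * t%:C) = cis t.
Proof.
rewrite /cexp Re_mulc Im_mulc /= !mul0r mulr0 mul1r subrr expR0 add0r.
by rewrite mul1r.
Qed.

Lemma intr_complex (R : realType) (k : int) : (k%:~R : R[i]) = (k%:~R : R)%:C.
Proof. by rewrite rmorph_int. Qed.

Lemma cexp_phase (R : realType) (k l : int) (x y : R) :
  cexp (- ('i%C * (k%:~R * x%:C + l%:~R * y%:C))) =
  cis (- (k%:~R * x + l%:~R * y)).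
Proof.
by rewrite -cexp_imag !intr_complex -mulrN -!rmorphM -rmorphD -rmorphN.
Qed.

Lemma kp_symbolE (R : realType) (k l : int) :
  kp_symbol R k l = 'i%C * (k%:~R ^+ 3 - l%:~R ^+ 2 / k%:~R)%:C.
Proof.
have i0 : ('i%C : R[i]) != 0 by rewrite eq_complex /= oner_eq0 andbF.
have i3 : ('i%C : R[i]) ^+ 3 = - 'i%C by rewrite exprS sqr_i mulrN1.
have iV : ('i%C : R[i])^-1 = - 'i%C.
  by apply: (mulfI i0); rewrite mulfV// mulrN -expr2 sqr_i opprK.
rewrite /kp_symbol !intr_complex rmorphB rmorphXn rmorphM rmorphXn fmorphV /=.
rewrite !exprMn invfM i3 iV sqr_i.
by ring.
Qed.

Lemma cexp_symbol (R : realType) (t : R) (k l : int) :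
  cexp (t%:C * kp_symbol R k l) =
  cis (t * (k%:~R ^+ 3 - l%:~R ^+ 2 / k%:~R)).
Proof. by rewrite kp_symbolE mulrCA -rmorphM cexp_imag. Qed.

(** By the mean value theorem, as the derivative is bounded by 1. *)
Lemma ler_dist_cos (R : realType) (a b : R) : `|cos a - cos b| <= `|a - b|.
Proof.
wlog ab : a b / b <= a.
  by move=> H; have [/H//|/ltW/H] := leP b a; rewrite distrC (distrC a).
have [c _ ->] := @MVT_segment R cos (fun x => - sin x) b a ab
  (fun x _ => is_derive_cos x) (continuous_subspaceT (@continuous_cos R)).
by rewrite normrM normrN ler_piMl// sin_max.
Qed.

Lemma ler_dist_sin (R : realType) (a b : R) : `|sin a - sin b| <= `|a - b|.
Proof. by rewrite -!cosBpihalf (le_trans (ler_dist_cos _ _))// opprB addrA subrK. Qed.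

(** The Fourier coefficients, at frequencies [j - N], of the profile
    [((1 + cos th) / 2)^N]. *)
Definition bin_weight (R : realType) (N j : nat) : R :=
  'C(N.*2, j)%:R / 4 ^+ N.

Lemma bin_weight_ge0 (R : realType) N j : 0 <= bin_weight R N j.
Proof. by rewrite divr_ge0 ?exprn_ge0. Qed.

(** Expansion of [(1 + e^{i th})^{2N}], combined with
    [(1 + e^{i th})^2 = e^{i th} (2 + 2 cos th)]: shifting the frequencies by N
    makes the sum real and nonnegative up to the phase [al]. *)
Lemma bin_weight_cis (R : realType) (N : nat) (al th : R) :
  \sum_(j < N.*2.+1) (bin_weight R N j)%:C * cis (al + (j%:R - N%:R) * th) =
  (((1 + cos th) / 2) ^+ N)%:C * cis al.
Proof.
have E : (1 + cis th) ^+ N.*2 = cis (N%:R * th) * ((2 + 2 * cos th) ^+ N)%:C.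
  rewrite -muln2 mulnC exprM cisMn rmorphXn -exprMn; congr (_ ^+ N).
  have H := cos2Dsin2 th; apply: eqc_ReIm;
    rewrite expr2 ?Re_mulc ?Im_mulc Re_addc Im_addc /=; last by ring.
  have Hs : sin th * sin th = 1 - cos th ^+ 2 by rewrite -H; ring.
  by rewrite add0r Hs; ring.
transitivity (cis al * cis (- (N%:R * th)) * (4 ^+ N)^-1%:C *
              (1 + cis th) ^+ N.*2).
  rewrite (exprDn 1 (cis th)) mulr_sumr; apply: eq_bigr => j _.
  rewrite expr1n mul1r -cisMn /bin_weight mulrBl addrCA cisD rmorphM /=.
  rewrite rmorph_nat -mulr_natr (_ : al - _ = al + - (N%:R * th))// cisD.
  ring.
rewrite E mulrC [_ * cis (- _)]mulrC !mulrA.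
rewrite (_ : (1 + cos th) / 2 = (2 + 2 * cos th) / 4); last by field.
rewrite expr_div_n [in RHS]rmorphM /=.
transitivity (cis (- (N%:R * th)) * cis (N%:R * th) *
  (((2 + 2 * cos th) ^+ N)%:C * (4 ^+ N)^-1%:C * cis al)); first by ring.
by rewrite cisN_mul mul1r.
Qed.

Lemma sum_bin_weight (R : realType) N :
  \sum_(j < N.*2.+1) bin_weight R N j = 1.
Proof.
have := exprDn (1 : R) 1 N.*2.
rewrite -muln2 mulnC exprM.
under eq_bigr do rewrite !expr1n mul1r.
rewrite mulnC muln2 /bin_weight -mulr_suml => <-.
by rewrite (_ : (1 + 1) ^+ 2 = 4 :> R) ?divff ?expf_neq0//; ring.
Qed.

(** The central coefficient is within a factor [2N + 1] of the sum of all of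
    them; only this polynomial loss has to be beaten by [q^N]. *)
Lemma bin_weight_mid (R : realType) N :
  (N.*2.+1%:R)^-1 <= bin_weight R N N.
Proof.
(* Induction on N, from C(2N+2, N+1) = 2 C(2N+1, N) and
   (N+1) C(2N+1, N) = (2N+1) C(2N, N). *)
have H : (4 ^ N <= N.*2.+1 * 'C(N.*2, N))%N.
  elim: N => [//|N IH].
  have E1 : 'C(N.+1.*2, N.+1) = ('C(N.*2.+1, N)).*2.
    rewrite doubleS binS -[RHS]addnn; congr (_ + _)%N.
    by rewrite -[LHS]bin_sub; [congr 'C(_, _); lia|lia].
  have E2 : (N.+1 * 'C(N.*2.+1, N) = N.*2.+1 * 'C(N.*2, N))%N.
    by rewrite [RHS](mul_bin_down N.*2.+1 N); congr (_ * _)%N; lia.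
  rewrite -(@leq_pmul2l N.+1)// E1.
  have := expnS 4 N; nia.
rewrite /bin_weight ler_pdivlMr ?exprn_gt0// mulrC ler_pdivrMr ?ltr0n//.
by rewrite -natrX -natrM ler_nat mulnC.
Qed.

(** Since the weights are nonnegative of sum 1, moving every phase by at most G
    moves the real and imaginary parts by at most G. This is the form in which
    the near-invariance of the profile under the flow is used: [ga j] will be
    the part [t l^2 / k] of the dispersion relation. *)
Lemma perturbed_bin_weight_le (R : realType) (N : nat) (al th G : R)
    (ga : 'I_N.*2.+1 -> R) (S := \sum_(j < N.*2.+1)
    (bin_weight R N j)%:C * cis (al + (j%:R - N%:R) * th + ga j)) :
  (forall j, `|ga j| <= G) ->
  `|complex.Re S| <= ((1 + cos th) / 2) ^+ N + G /\
  `|complex.Im S| <= ((1 + cos th) / 2) ^+ N + G.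
Proof.
move=> gaG.
have rho0 : 0 <= ((1 + cos th) / 2) ^+ N.
  by rewrite exprn_ge0// divr_ge0//; have := cos_geN1 th; lra.
have GE : G = \sum_(j < N.*2.+1) bin_weight R N j * G.
  by rewrite -mulr_suml sum_bin_weight mul1r.
have S0 := bin_weight_cis N al th.
have Fbound (F : R -> R) : (forall a b, `|F a - F b| <= `|a - b|) ->
    `|\sum_(j < N.*2.+1) bin_weight R N j * F (al + (j%:R - N%:R) * th)| <=
      ((1 + cos th) / 2) ^+ N ->
    `|\sum_(j < N.*2.+1) bin_weight R N j * F (al + (j%:R - N%:R) * th + ga j)|
      <= ((1 + cos th) / 2) ^+ N + G.
  move=> FL F0; rewrite -[X in `|X|](subrK (\sum_(j < N.*2.+1)
    bin_weight R N j * F (al + (j%:R - N%:R) * th))) addrC.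
  rewrite (le_trans (ler_normD _ _))// lerD// GE -sumrB.
  rewrite (le_trans (ler_norm_sum _ _ _))// ler_sum// => j _.
  rewrite -mulrBr normrM ger0_norm ?bin_weight_ge0// ler_wpM2l ?bin_weight_ge0//.
  by rewrite (le_trans (FL _ _))// [X in `|X|]addrAC subrr add0r.
have ReE (h : 'I_N.*2.+1 -> R) :
    complex.Re (\sum_(j < N.*2.+1) (bin_weight R N j)%:C * cis (h j)) =
    \sum_(j < N.*2.+1) bin_weight R N j * cos (h j).
  by rewrite raddf_sum; apply: eq_bigr => j _; rewrite /= mul0r subr0.
have ImE (h : 'I_N.*2.+1 -> R) :
    complex.Im (\sum_(j < N.*2.+1) (bin_weight R N j)%:C * cis (h j)) =
    \sum_(j < N.*2.+1) bin_weight R N j * sin (h j).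
  by rewrite raddf_sum; apply: eq_bigr => j _; rewrite /= mul0r addr0.
rewrite /S ReE ImE; split; apply: Fbound.
- exact: ler_dist_cos.
- rewrite -ReE S0 Re_mulc /= mul0r subr0 normrM (ger0_norm rho0) ler_piMr//.
  by rewrite ler_norml cos_geN1 cos_le1.
- exact: ler_dist_sin.
- rewrite -ImE S0 Im_mulc /= mul0r addr0 normrM (ger0_norm rho0) ler_piMr//.
  exact: sin_max.
Qed.

Lemma cosD2pin (R : realType) (x : R) (n : int) :
  cos (x + n%:~R * (2 * pi)) = cos x.
Proof.
rewrite mulrzl (mulr_natl pi 2); case: n => k; first exact: (periodicn (@cosD2pi R)).
by rewrite NegzE mulrNz -[LHS](periodicn (@cosD2pi R) k.+1) -pmulrn subrK.
Qed.

(** The point [(a + b) / 2 + pi] is the middle of the complement of the strip.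
    A point of the strip is at distance less than [(b - a) / 2 < pi] from
    [(a + b) / 2] modulo [2 pi], and cos decreases on [[0, pi]]. *)
Lemma outside_strip (R : realType) (a b y : R) (n : int) :
  b - a < 2 * pi -> a < y + n%:~R * (2 * pi) < b ->
  (1 + cos ((a + b) / 2 + pi - y)) / 2 <= (1 - cos ((b - a) / 2)) / 2.
Proof.
move=> ba /andP[ay yb]; rewrite ler_pM2r ?invr_gt0// lerD2l.
set z := y + _ in ay yb.
have -> : cos ((a + b) / 2 + pi - y) = - cos (z - (a + b) / 2).
  rewrite addrAC cosDpi -cosN opprB -(cosD2pin _ n); congr (- cos _).
  by rewrite /z addrAC.
have dz : `|z - (a + b) / 2| < (b - a) / 2.
  by rewrite ltr_norml; apply/andP; split; lra.
have hpi : (b - a) / 2 < pi by lra.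
have d0 := normr_ge0 (z - (a + b) / 2).
rewrite lerN2 -(cos_norm (z - _)) ltW// ltr_cos// in_itv/=;
  apply/andP; split; lra.
Qed.

Lemma strip_ratio_bound (R : realType) (a b : R) :
  0 < b - a -> b - a < 2 * pi -> 0 <= (1 - cos ((b - a) / 2)) / 2 < 1.
Proof.
move=> ba0 ba; have := cos_le1 ((b - a) / 2).
have : cos pi < cos ((b - a) / 2).
  by rewrite ltr_cos ?in_itv/= ?pi_ge0 ?lexx//; lra.
by rewrite cospi => *; apply/andP; split; lra.
Qed.

(** * Fubini on rectangles *)

Section Product.
Context d0 d1 d2 (T0 : measurableType d0) (T1 : measurableType d1)
  (T2 : measurableType d2) (R : realType).
Variable m1 : {sigma_finite_measure set T1 -> \bar R}.
Variable m2 : {sigma_finite_measure set T2 -> \bar R}.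
Local Open Scope ereal_scope.

(** Two applications of Tonelli's theorem after reassociating the product. *)
Lemma measurable_integral_prod (f : T0 * (T1 * T2) -> \bar R) :
  measurable_fun setT f -> (forall z, 0 <= f z) ->
  measurable_fun setT (fun t => \int[m1 \x m2]_p f (t, p)).
Proof.
move=> mf f0.
pose f1 (z : (T0 * T1) * T2) := f (z.1.1, (z.1.2, z.2)).
have mf1 : measurable_fun setT f1.
  apply: (@measurableT_comp _ _ _ _ _ _ f) => //.
  apply/measurable_fun_pair; last apply/measurable_fun_pair.
  - exact: (measurableT_comp measurable_fst measurable_fst).
  - exact: (measurableT_comp measurable_snd measurable_fst).
  - exact: measurable_snd.
have mF := @measurable_fun_fubini_tonelli_F _ _ _ _ _ m2 f1 mf1 (fun=> f0 _).
have F0 z : 0 <= fubini_F m2 f1 z by apply: integral_ge0 => y _; exact: f0.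
have := @measurable_fun_fubini_tonelli_F _ _ _ _ _ m1 _ mF F0.
apply: eq_measurable_fun => t _.
rewrite fubini_tonelli1//.
exact: (measurableT_comp mf (measurable_pair1 t)).
Qed.

Variables (A1 : set T1) (A2 : set T2).
Hypotheses (mA1 : measurable A1) (mA2 : measurable A2).

Let mA12 : measurable (A1 `*` A2). Proof. exact: measurableX. Qed.

Lemma patch_setX (f : T1 * T2 -> \bar R) x y :
  (f \_ (A1 `*` A2)) (x, y) =
  if x \in A1 then ((fun y => f (x, y)) \_ A2) y else 0.
Proof.
rewrite !patchE in_setX /=.
by case: (x \in A1).
Qed.

Lemma fubini_F_patch (f : T1 * T2 -> \bar R) :
  fubini_F m2 (f \_ (A1 `*` A2)) = (fun x => \int[m2]_(y in A2) f (x, y)) \_ A1.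
Proof.
apply/funext => x; rewrite /fubini_F patchE.
under eq_integral do rewrite patch_setX.
by case: ifPn => xA1; rewrite ?integral0// [RHS]integral_mkcond.
Qed.

Lemma fubini_G_patch (f : T1 * T2 -> \bar R) :
  fubini_G m1 (f \_ (A1 `*` A2)) = (fun y => \int[m1]_(x in A1) f (x, y)) \_ A2.
Proof.
apply/funext => y; rewrite /fubini_G patchE.
under eq_integral do rewrite patchE in_setX /=.
case: ifPn => yA2; last by under eq_integral do rewrite andbF; rewrite integral0.
by rewrite [RHS]integral_mkcond; under eq_integral do rewrite andbT.
Qed.

Lemma integral_setX12 (f : T1 * T2 -> \bar R) :
  (m1 \x m2).-integrable (A1 `*` A2) f ->
  \int[m1 \x m2]_(p in A1 `*` A2) f p =
  \int[m1]_(x in A1) \int[m2]_(y in A2) f (x, y).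
Proof.
move=> /(integrable_mkcond _ mA12) fi.
rewrite [LHS]integral_mkcond.
rewrite -(integral12_prod_meas1 fi).
rewrite fubini_F_patch.
exact/esym/integral_mkcond.
Qed.

Lemma integral_setX21 (f : T1 * T2 -> \bar R) :
  (m1 \x m2).-integrable (A1 `*` A2) f ->
  \int[m1 \x m2]_(p in A1 `*` A2) f p =
  \int[m2]_(y in A2) \int[m1]_(x in A1) f (x, y).
Proof.
move=> /(integrable_mkcond _ mA12) fi.
rewrite [LHS]integral_mkcond.
rewrite -(integral21_prod_meas1 fi).
rewrite fubini_G_patch.
exact/esym/integral_mkcond.
Qed.

Lemma ge0_integral_setX12 (f : T1 * T2 -> \bar R) :
  measurable_fun (A1 `*` A2) f -> (forall p, 0 <= f p) ->
  \int[m1 \x m2]_(p in A1 `*` A2) f p =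
  \int[m1]_(x in A1) \int[m2]_(y in A2) f (x, y).
Proof.
move=> /(measurable_restrictT f mA12) mf f0.
rewrite [LHS]integral_mkcond.
rewrite (fubini_tonelli1 _ mf); last by move=> p; rewrite patchE; case: ifP.
rewrite fubini_F_patch.
exact/esym/integral_mkcond.
Qed.

Lemma ge0_measurable_marginal (f : T1 * T2 -> \bar R) :
  measurable_fun (A1 `*` A2) f -> (forall p, 0 <= f p) ->
  measurable_fun A1 (fun x => \int[m2]_(y in A2) f (x, y)).
Proof.
move=> /(measurable_restrictT f mA12) mf f0.
apply/(measurable_restrictT _ mA1); rewrite -fubini_F_patch.
by apply: (measurable_fun_fubini_tonelli_F _ mf) => p; rewrite patchE; case: ifP.
Qed.

Lemma measurable_fun_slice (f : T1 * T2 -> \bar R) x : A1 x ->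
  measurable_fun (A1 `*` A2) f -> measurable_fun A2 (fun y => f (x, y)).
Proof.
move=> A1x /(measurable_restrictT f mA12) mf.
apply/(measurable_restrictT _ mA2).
have := measurableT_comp mf (measurable_pair1 x).
apply: eq_measurable_fun => y _ /=.
by rewrite patch_setX mem_set.
Qed.

(** Integrating out the second variable and regarding the result as a function
    of both variables again costs a factor [m2 A2] in L^1. *)
Lemma marginal_integral (r : T1 * T2 -> R)
    (H := fun x => Rintegral m2 A2 (fun y => r (x, y))) :
  m2 A2 < +oo -> (m1 \x m2).-integrable (A1 `*` A2) (EFin \o r) ->
  (m1 \x m2).-integrable (A1 `*` A2) (fun p => (H p.1)%:E) /\
  \int[m1 \x m2]_(p in A1 `*` A2) (`|H p.1|%R)%:E <=
    m2 A2 * \int[m1 \x m2]_(p in A1 `*` A2) (`|r p|%R)%:E.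
Proof.
move=> A2oo ir.
have /(integrable_mkcond _ mA12) ir' := ir.
have mr : measurable_fun (A1 `*` A2) (EFin \o r) by exact: measurable_int ir.
have mH : measurable_fun A1 H.
  apply/(measurable_restrictT _ mA1).
  have := measurableT_comp (fine_measurable measurableT) (measurable_fubini_F ir').
  rewrite fubini_F_patch.
  apply: eq_measurable_fun => x _ /=.
  by rewrite !patchE; case: ifP.
have mHfst : measurable_fun (A1 `*` A2) (fun p => (H p.1)%:E).
  apply/measurable_EFinP; apply: (@measurable_comp _ _ _ _ _ _ A1 H) => //.
    by move=> _ [p [Ap _] <-].
  exact: measurable_funTS measurable_fst.
have nmr : measurable_fun (A1 `*` A2) (EFin \o (fun p => `|r p|)%R).
  by apply/measurable_EFinP/measurableT_comp => //; exact/measurable_EFinP.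
have nmH : measurable_fun (A1 `*` A2) (EFin \o (fun p => `|H p.1|)%R).
  by apply/measurable_EFinP/measurableT_comp => //; exact/measurable_EFinP.
have le1 : \int[m1 \x m2]_(p in A1 `*` A2) (`|H p.1|%R)%:E <=
    m2 A2 * \int[m1 \x m2]_(p in A1 `*` A2) (`|r p|%R)%:E.
  rewrite !ge0_integral_setX12//=.
  under eq_integral do rewrite integral_cst// muleC.
  rewrite ge0_integralZl//; last first.
    by apply/measurable_EFinP/measurableT_comp => //; exact/measurable_EFinP.
  rewrite lee_wpmul2l// ge0_le_integral//.
  - by apply/measurable_EFinP/measurableT_comp => //; exact/measurable_EFinP.
  - by apply: (ge0_measurable_marginal nmr) => p; rewrite lee_fin.
  - move=> x A1x; have mrx := measurable_fun_slice A1x mr.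
    apply: le_trans (le_abse_integral m2 mA2 mrx).
    (* H vanishes where the inner integral is infinite. *)
    rewrite /H /Rintegral; case: (\int[m2]_(y in A2) _) => [u| |] //=.
      by rewrite normr0 leey.
    by rewrite normr0 leey.
split=> //; apply/integrableP; split => //.
apply: (le_lt_trans le1).
by rewrite lte_mul_pinfty// ?ge0_fin_numE//; have /integrableP[] := ir.
Qed.
End Product.

Lemma bounded_integrable d (X : measurableType d) (R : realType)
    (m : {measure set X -> \bar R}) (D : set X) (f : X -> R) (M : R) :
  measurable D -> (m D < +oo)%E -> measurable_fun D f ->
  (forall x, D x -> `|f x| <= M) -> m.-integrable D (EFin \o f).
Proof.
move=> mD Doo mf fM; apply: measurable_bounded_integrable => //.
exists M; split; first exact: num_real.
by move=> y My x /= /fM /le_trans; apply; exact: ltW.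
Qed.

(** * Exponentials on the torus *)

Section Torus.
Variable R : realType.
Local Notation rR := (measurableTypeR R).
Local Notation T1 := (@Defs.T1 R).
Local Notation T2 := (@Defs.T2 R).
Local Notation leb1 := (leb1 R).
Local Notation leb2 := (leb2 R).

Lemma measurable_T1 : measurable (T1 : set rR).
Proof. exact: measurable_itv. Qed.

Lemma measurable_T2 : measurable (T2 : set (rR * rR)%type).
Proof. exact: (measurableX measurable_T1 measurable_T1). Qed.

Lemma leb1_T1 : leb1 T1 = (2 * pi)%:E.
Proof.
by rewrite /Defs.T1 lebesgue_measure_itv/= lte_fin mulr_gt0 ?pi_gt0// oppr0 adde0.
Qed.

Lemma leb2_T2 : leb2 T2 = ((2 * pi) ^+ 2)%:E.
Proof.
rewrite product_measure1E; [|exact: measurable_T1|exact: measurable_T1].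
by rewrite expr2 EFinM -leb1_T1.
Qed.

Lemma leb2_T2_lty : (leb2 T2 < +oo)%E.
Proof. by rewrite leb2_T2 ltey. Qed.

Lemma integral_T1_cos (al : R) (n : int) : n != 0 ->
  (\int[leb1]_(y in T1) (cos (al + n%:~R * y))%:E = 0)%E.
Proof.
move=> n0; have nR : (n%:~R : R) != 0 by rewrite intr_eq0.
have der (x : R) : is_derive x 1 (fun y => (n%:~R)^-1 * sin (al + n%:~R * y))
    (cos (al + n%:~R * x)).
  apply: is_derive_eq.
  by rewrite /GRing.scale /=; field.
have cf : continuous (fun y : R => cos (al + n%:~R * y)).
  move=> y; apply: continuous_comp; last exact: continuous_cos.
  by apply: cvgD; [exact: cvg_cst|apply: cvgM; [exact: cvg_cst|exact: cvg_id]].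
have cF : continuous (fun y : R => (n%:~R)^-1 * sin (al + n%:~R * y)).
  by move=> y; apply/differentiable_continuous/derivable1_diffP; case: (der y).
have mf : measurable_fun setT (fun y : R => cos (al + n%:~R * y)).
  exact: continuous_measurable_fun cf.
rewrite integral_itv_bndo_bndc; last first.
  by apply/measurable_EFinP; exact: measurable_funTS mf.
rewrite (@continuous_FTC2 R (fun y => cos (al + n%:~R * y))
  (fun y => (n%:~R)^-1 * sin (al + n%:~R * y)) 0 (2 * pi)).
- rewrite -EFinB mulr0 addr0 -(cosBpihalf (al + _)) addrAC cosD2pin.
  by rewrite cosBpihalf subrr.
- by rewrite mulr_gt0 ?pi_gt0.
- exact: continuous_subspaceT.
- split; first by move=> x _; case: (der x).
  + by apply: cvg_at_right_filter; exact: cF.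
  + by apply: cvg_at_left_filter; exact: cF.
- by move=> x _; rewrite derive1E; case: (der x).
Qed.

Lemma measurable_phase (al m n : R) :
  measurable_fun T2 (fun p : R * R => cos (al + m * p.1 + n * p.2)).
Proof.
have mcos := continuous_measurable_fun (@continuous_cos R).
apply: (measurableT_comp mcos).
apply: measurable_funD; first apply: measurable_funD.
- exact: measurable_cst.
- apply: measurable_funM; [exact: measurable_cst|].
  exact: measurable_funTS measurable_fst.
- apply: measurable_funM; [exact: measurable_cst|].
  exact: measurable_funTS measurable_snd.
Qed.

Lemma integrable_phase (al m n : R) :
  leb2.-integrable T2 (fun p : R * R => (cos (al + m * p.1 + n * p.2))%:E).
Proof.
apply: (@bounded_integrable _ _ _ leb2 T2 _ 1 measurable_T2).
- exact: leb2_T2_lty.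
- exact: measurable_phase.
- by move=> p _; rewrite ler_norml cos_geN1 cos_le1.
Qed.

(** The variable with the nonzero frequency is integrated first. *)
Lemma integral_T2_cos (al : R) (m n : int) : (m != 0) || (n != 0) ->
  Rintegral leb2 T2 (fun p => cos (al + m%:~R * p.1 + n%:~R * p.2)) = 0.
Proof.
move=> /orP mn; rewrite /Rintegral.
have I := integrable_phase al m%:~R n%:~R.
have [n0|n0] := eqVneq n 0.
  rewrite (integral_setX21 measurable_T1 measurable_T1 I).
  rewrite integral0_eq// => y _ /=.
  case: mn; last by rewrite n0.
  move=> m0; under eq_integral do rewrite addrAC.
  exact: integral_T1_cos.
rewrite (integral_setX12 measurable_T1 measurable_T1 I).
rewrite integral0_eq// => x _ /=.
exact: integral_T1_cos.
Qed.

Lemma cmeasurable_cis (al m n : R) :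
  cmeasurable T2 (fun p : R * R => cis (al + m * p.1 + n * p.2)).
Proof.
split; first exact: measurable_phase.
under [X in measurable_fun _ X]eq_fun do rewrite /= -cosBpihalf addrAC [_ + _ - _]addrAC.
exact: measurable_phase.
Qed.

Lemma cintegrable_cis (al m n : R) :
  cintegrable leb2 T2 (fun p : R * R => cis (al + m * p.1 + n * p.2)).
Proof.
split; first exact: integrable_phase.
under eq_fun do rewrite /= -cosBpihalf addrAC [_ + _ - _]addrAC.
exact: integrable_phase.
Qed.

Lemma cintegral_cis (m n : int) :
  cintegral leb2 T2 (fun p => cis (m%:~R * p.1 + n%:~R * p.2)) =
  (((2 * pi) ^+ 2) *+ ((m == 0) && (n == 0)))%:C.
Proof.
have [/andP[/eqP-> /eqP->]|] := boolP ((m == 0) && (n == 0)).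
  apply: eqc_ReIm => /=.
  - under eq_Rintegral do rewrite !mul0r addr0 cos0.
    by rewrite (Rintegral_cst leb2 measurable_T2) mul1r [X in fine X]leb2_T2.
  - under eq_Rintegral do rewrite !mul0r addr0 sin0.
    by rewrite (Rintegral_cst leb2 measurable_T2) mul0r.
rewrite negb_and => mn; apply: eqc_ReIm => /=.
- by rewrite -[RHS](integral_T2_cos 0 mn); apply: eq_Rintegral => p _; rewrite add0r.
- rewrite -[RHS](integral_T2_cos (- (pi / 2)) mn); apply: eq_Rintegral => p _.
  by rewrite -cosBpihalf; congr cos; ring.
Qed.

End Torus.

(** * Square-integrable functions and Fourier coefficients *)

(** Stated for a bundled measure: in [eq_T2] the product measure appears as a
    plain set function, on which the filter structure is not inferred. *)
Lemma ae_imply d (X : measurableType d) (R : realType)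
    (m : {measure set X -> \bar R}) (P Q : X -> Prop) :
  (forall x, P x -> Q x) -> {ae m, forall x, P x} -> {ae m, forall x, Q x}.
Proof. by move=> PQ; exact: filterS. Qed.

Section FourierTorus.
Variable R : realType.
Local Notation T1 := (@Defs.T1 R).
Local Notation T2 := (@Defs.T2 R).
Local Notation leb1 := (leb1 R).
Local Notation leb2 := (leb2 R).
Implicit Types (v w : R * R -> R[i]).

Let mT2 := @measurable_T2 R.

Lemma sqr_normc (z : R[i]) :
  Normc.normc z ^+ 2 = complex.Re z ^+ 2 + complex.Im z ^+ 2.
Proof. by case: z => x y; rewrite /= sqr_sqrtr// addr_ge0// sqr_ge0. Qed.

Lemma measurable_sqr_normc d (X : measurableType d) (D : set X) (v : X -> R[i]) :
  cmeasurable D v -> measurable_fun D (fun p => Normc.normc (v p) ^+ 2).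
Proof.
move=> [m1 m2]; under [X in measurable_fun _ X]eq_fun do rewrite sqr_normc.
by apply: measurable_funD; exact: measurable_funX.
Qed.

Lemma integrable_sqnorm v : L2_T2 v ->
  leb2.-integrable T2 (fun p => (Normc.normc (v p) ^+ 2)%:E).
Proof.
move=> [mv vfin]; apply/integrableP; split.
  by apply/measurable_EFinP; exact: measurable_sqr_normc mv.
by under eq_integral do rewrite gee0_abs ?lee_fin ?sqr_ge0//.
Qed.

Lemma integrable_cst_T2 (c : R) : leb2.-integrable T2 (fun=> c%:E).
Proof.
apply: (@bounded_integrable _ _ _ leb2 T2 (fun=> c) `|c| mT2) => //.
exact: leb2_T2_lty.
Qed.

(** [1 + |v|^2] dominates the real and imaginary parts of v and is integrable
    on the torus, which has finite measure. Its integral is affine in the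
    squared norm of v, hence ready to be integrated in time. *)
Lemma integrable_dominator v : L2_T2 v ->
  leb2.-integrable T2 (EFin \o (fun p => 1 + Normc.normc (v p) ^+ 2)).
Proof.
by move=> v2; exact: (integrableD mT2 (integrable_cst_T2 1) (integrable_sqnorm v2)).
Qed.

Lemma Rintegral_dominator v : L2_T2 v ->
  Rintegral leb2 T2 (fun p => 1 + Normc.normc (v p) ^+ 2) =
  (2 * pi) ^+ 2 + fine (sqnorm_T2 v).
Proof.
move=> v2; rewrite (RintegralD mT2 (integrable_cst_T2 1) (integrable_sqnorm v2)).
by rewrite (Rintegral_cst leb2 mT2) mul1r [X in fine X + _]leb2_T2.
Qed.

Let norm_le_dominator (a b : R) : `|a| <= 1 + (a ^+ 2 + b ^+ 2).
Proof. by rewrite ler_norml; apply/andP; split; nra. Qed.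

Lemma L2_cintegrable v : L2_T2 v -> cintegrable leb2 T2 v.
Proof.
move=> v2; have [[mRe mIm] _] := v2.
split; apply: (le_integrable mT2 _ _ (integrable_dominator v2)).
- by apply/measurable_EFinP.
- move=> p _ /=; rewrite lee_fin (le_trans _ (ler_norm _))// sqr_normc.
  exact: norm_le_dominator.
- by apply/measurable_EFinP.
- move=> p _ /=; rewrite lee_fin (le_trans _ (ler_norm _))// sqr_normc.
  by rewrite [X in 1 + X]addrC; exact: norm_le_dominator.
Qed.

Lemma Rintegral_norm_ReIm_le v : L2_T2 v ->
  Rintegral leb2 T2 (fun p => `|complex.Re (v p)|) <=
    (2 * pi) ^+ 2 + fine (sqnorm_T2 v) /\
  Rintegral leb2 T2 (fun p => `|complex.Im (v p)|) <=
    (2 * pi) ^+ 2 + fine (sqnorm_T2 v).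
Proof.
move=> v2; have [iRe iIm] := L2_cintegrable v2.
rewrite -Rintegral_dominator//; split; apply: le_Rintegral => //.
- exact: (integrable_norm iRe).
- exact: integrable_dominator.
- by move=> p _; rewrite sqr_normc; exact: norm_le_dominator.
- exact: (integrable_norm iIm).
- exact: integrable_dominator.
- by move=> p _; rewrite sqr_normc [X in 1 + X]addrC; exact: norm_le_dominator.
Qed.

(** The conjugate of [e^{i(kx + ly)}], which is what [fourier] integrates
    against. *)
Definition mode (k l : int) (p : R * R) : R[i] :=
  cis (- (k%:~R * p.1 + l%:~R * p.2)).

Lemma cmeasurable_mode k l : cmeasurable T2 (mode k l).
Proof.
have := cmeasurable_cis 0 (- (k%:~R : R)) (- l%:~R).
by congr cmeasurable; apply/funext => p; rewrite /mode; congr cis; ring.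
Qed.

Lemma norm_cis_le (t : R) :
  `|complex.Re (cis t)| <= 1 /\ `|complex.Im (cis t)| <= 1.
Proof. by rewrite /= sin_max ler_norml cos_geN1 cos_le1. Qed.

Lemma cintegrable_mul_mode v k l : cintegrable leb2 T2 v ->
  cintegrable leb2 T2 (fun p => v p * mode k l p).
Proof.
move=> iv; apply: (@cintegrable_bounded_mul _ _ _ _ _ mT2 _ _ 1 iv).
  exact: cmeasurable_mode.
by move=> p _; exact: norm_cis_le.
Qed.

Lemma fourierE v k l : fourier v k l =
  (((2 * pi) ^+ 2)^-1)%:C * cintegral leb2 T2 (fun p => v p * mode k l p).
Proof.
by congr (_ * _); apply: eq_cintegral => p _; rewrite cexp_phase.
Qed.

Lemma cintegral_mode v k l :
  cintegral leb2 T2 (fun p => v p * mode k l p) =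
  ((2 * pi) ^+ 2)%:C * fourier v k l.
Proof.
rewrite fourierE mulrA -rmorphM divff ?mul1r//.
by rewrite expf_neq0// mulf_neq0// gt_eqF// pi_gt0.
Qed.

Lemma fourierD v w k l : cintegrable leb2 T2 v -> cintegrable leb2 T2 w ->
  fourier (v \+ w) k l = fourier v k l + fourier w k l.
Proof.
move=> iv iw; rewrite !fourierE -mulrDr -cintegralD//.
- by congr (_ * _); apply: eq_cintegral => p _; rewrite /= mulrDl.
- exact: cintegrable_mul_mode.
- exact: cintegrable_mul_mode.
Qed.

Lemma eq_fourier v w k l : cintegrable leb2 T2 v -> cintegrable leb2 T2 w ->
  eq_T2 v w -> fourier v k l = fourier w k l.
Proof.
move=> iv iw vw; rewrite !fourierE; congr (_ * _).
apply: (ae_eq_cintegral mT2).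
- exact: cintegrable_mul_mode.
- exact: cintegrable_mul_mode.
- apply: (@ae_imply _ _ _ leb2 _ _ _ vw) => p vwp Tp.
  by rewrite vwp.
Qed.

Lemma cintegral_trig_poly v n (d : 'I_n -> R[i]) (k : int) (l : 'I_n -> int) :
  cintegrable leb2 T2 v ->
  cintegral leb2 T2 (fun p => v p * \sum_(j < n) d j * mode k (l j) p) =
  ((2 * pi) ^+ 2)%:C * \sum_(j < n) d j * fourier v k (l j).
Proof.
move=> iv.
transitivity (cintegral leb2 T2
    (fun p => \sum_(j < n) d j * (v p * mode k (l j) p))).
  apply: eq_cintegral => p _; rewrite mulr_sumr.
  by apply: eq_bigr => j _; rewrite mulrCA.
rewrite cintegral_sum//.
  rewrite mulr_sumr; apply: eq_bigr => j _.
  rewrite cintegralZ//; last exact: cintegrable_mul_mode.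
  by rewrite cintegral_mode mulrCA.
by move=> j; apply: cintegrableZ => //; exact: cintegrable_mul_mode.
Qed.

(** From [|v + w|^2 <= 2 |v|^2 + 2 |w|^2]. *)
Lemma L2_T2D v w : L2_T2 v -> L2_T2 w -> L2_T2 (v \+ w).
Proof.
move=> v2 w2; have [[v1 v3] _] := v2; have [[w1 w3] _] := w2.
have mvw : cmeasurable T2 (v \+ w).
  split.
  - by under [X in measurable_fun _ X]eq_fun do rewrite /= Re_addc; exact: measurable_funD.
  - by under [X in measurable_fun _ X]eq_fun do rewrite /= Im_addc; exact: measurable_funD.
split=> //.
have I : leb2.-integrable T2 (EFin \o (fun p =>
    2 * Normc.normc (v p) ^+ 2 + 2 * Normc.normc (w p) ^+ 2)).
  apply: (integrableD mT2 (integrableZl mT2 2 (integrable_sqnorm v2))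
    (integrableZl mT2 2 (integrable_sqnorm w2))).
have /integrableP[_] : leb2.-integrable T2
    (EFin \o (fun p => Normc.normc (v p + w p) ^+ 2)).
  apply: (le_integrable mT2 _ _ I).
    by apply/measurable_EFinP; exact: measurable_sqr_normc mvw.
  move=> p _ /=; rewrite lee_fin ger0_norm ?sqr_ge0// (le_trans _ (ler_norm _))//.
  rewrite !sqr_normc Re_addc Im_addc.
  set a := complex.Re (v p); set b := complex.Re (w p).
  set c := complex.Im (v p); set d := complex.Im (w p).
  have := sqr_ge0 (a - b); have := sqr_ge0 (c - d).
  by rewrite !sqrrB !sqrrD; lra.
by under eq_integral do rewrite gee0_abs ?lee_fin ?sqr_ge0//.
Qed.

Lemma L2_T2_bounded v M : cmeasurable T2 v ->
  (forall p, `|complex.Re (v p)| <= M /\ `|complex.Im (v p)| <= M) -> L2_T2 v.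
Proof.
move=> mv vM; split=> //.
have /integrableP[_] : leb2.-integrable T2
    (EFin \o (fun p => Normc.normc (v p) ^+ 2)).
  apply: (@bounded_integrable _ _ _ leb2 T2 _ (M ^+ 2 + M ^+ 2) mT2).
  - exact: leb2_T2_lty.
  - exact: measurable_sqr_normc mv.
  - move=> p _; rewrite ger0_norm ?sqr_ge0// sqr_normc.
    have [h1 h2] := vM p; have M0 := le_trans (normr_ge0 _) h1.
    by rewrite lerD// -[X in X <= _]real_normK ?num_real// ler_pXn2r// nnegrE.
by under eq_integral do rewrite gee0_abs ?lee_fin ?sqr_ge0//.
Qed.

End FourierTorus.

(** * A lacunary function of x *)

(** The remainder is bounded by the geometric tail. *)
Lemma dyadic_series (R : realType) (u : nat -> R) :
  (forall m, `|u m| <= 2^-1 ^+ m) ->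
  cvgn (series u) /\
  forall n, `|limn (series u) - series u n| <= 2 * 2^-1 ^+ n.
Proof.
move=> ub.
have cu : cvgn (series u).
  apply: normed_cvg.
  apply: (@series_le_cvg _ (fun m => `|u m|) (geometric 1 2^-1)) => //.
  - by move=> m; rewrite /geometric /= mul1r exprn_ge0.
  - by move=> m; rewrite /geometric /= mul1r.
  - by apply: is_cvg_geometric_series; rewrite ger0_norm// invf_lt1// ltr1n.
split=> // n.
have step j : `|series u (n + j)%N - series u n| <=
    (2 - 2 * 2^-1 ^+ j) * 2^-1 ^+ n.
  elim: j => [|j IH]; first by rewrite addn0 subrr normr0 expr0 mulr1 subrr mul0r.
  rewrite addnS seriesSr addrAC (le_trans (ler_normD _ _))//.
  rewrite (le_trans (lerD IH (ub _)))// exprD exprS.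
  by rewrite le_eqVlt; apply/orP; left; apply/eqP; field.
have cn : series u k - series u n @[k --> \oo] --> limn (series u) - series u n.
  by apply: cvgB => //; exact: cvg_cst.
have cnn : `|series u k - series u n| @[k --> \oo] --> `|limn (series u) - series u n|.
  exact: cvg_norm cn.
rewrite -(cvg_lim _ cnn)//; apply: limr_le; first by apply/cvg_ex; eexists; exact: cnn.
near=> k.
have nk : (n <= k)%N by near: k; exact: nbhs_infty_ge.
rewrite -(subnKC nk) (le_trans (step _))// ler_wpM2r ?exprn_ge0//.
by rewrite gerBl mulr_ge0// exprn_ge0.
Unshelve. all: by end_near.
Qed.

Section Lacunary.
Variable R : realType.
Local Notation T2 := (@Defs.T2 R).
Local Notation leb2 := (leb2 R).
Let mT2 := @measurable_T2 R.

Lemma fourier_le_sup (v : R * R -> R[i]) (B : R) (k l : int) :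
  cmeasurable T2 v ->
  (forall p, `|complex.Re (v p)| <= B /\ `|complex.Im (v p)| <= B) ->
  `|complex.Re (fourier v k l)| <= 2 * B /\
  `|complex.Im (fourier v k l)| <= 2 * B.
Proof.
move=> mv vB.
have iv := L2_cintegrable (L2_T2_bounded mv vB).
have pi2 : 0 < (2 * pi : R) ^+ 2 by rewrite exprn_gt0// mulr_gt0// pi_gt0.
have bound (F : R * R -> R) : leb2.-integrable T2 (EFin \o F) ->
    (forall p, `|F p| <= 2 * B) ->
    `|((2 * pi) ^+ 2)^-1 * Rintegral leb2 T2 F| <= 2 * B.
  move=> iF FB; rewrite normrM gtr0_norm ?invr_gt0// ler_pdivrMl//.
  rewrite (le_trans (le_normr_Rintegral mT2 iF))//.
  have -> : (2 * pi) ^+ 2 * (2 * B) = Rintegral leb2 T2 (fun=> 2 * B).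
    by rewrite (Rintegral_cst leb2 mT2) [X in _ * fine X]leb2_T2 mulrC.
  apply: le_Rintegral => //; first exact: (integrable_norm iF).
  exact: integrable_cst_T2.
have [iRe iIm] := cintegrable_mul_mode k l iv.
have prodB (a b c d : R) : `|a| <= B -> `|b| <= B -> `|c| <= 1 -> `|d| <= 1 ->
    `|a * c + b * d| <= 2 * B.
  move=> aB bB c1 d1; rewrite (le_trans (ler_normD _ _))// !normrM mulr2n mulrDl.
  by rewrite !mul1r lerD// -[leRHS]mulr1 ler_pM.
rewrite fourierE Re_mulc Im_mulc /= !mul0r subr0 addr0.
split; apply: bound => // p; rewrite ?Re_mulc ?Im_mulc.
- have [h1 h2] := vB p; have [c1 d1] := norm_cis_le (- (k%:~R * p.1 + l%:~R * p.2)).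
  by rewrite -mulrN; apply: prodB => //; rewrite normrN.
- have [h1 h2] := vB p; have [c1 d1] := norm_cis_le (- (k%:~R * p.1 + l%:~R * p.2)).
  exact: prodB.
Qed.

Definition lacunary_term (F : R -> R) (x : R) (m : nat) : R :=
  2^-1 ^+ m * F ((64 ^ m)%:R * x).

Definition lacunary (p : R * R) : R[i] :=
  limn (series (lacunary_term cos p.1)) +i*
  limn (series (lacunary_term sin p.1)).

Definition lacunary_sum (n : nat) (p : R * R) : R[i] :=
  \sum_(m < n) (2^-1 ^+ m)%:C * cis ((64 ^ m)%:R * p.1).

Lemma lacunary_term_le (F : R -> R) x m : (forall t, `|F t| <= 1) ->
  `|lacunary_term F x m| <= 2^-1 ^+ m.
Proof.
by move=> F1; rewrite normrM ger0_norm ?exprn_ge0// ler_piMr ?exprn_ge0.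
Qed.

Lemma norm_cos_le1 (t : R) : `|cos t| <= 1.
Proof. by have [] := norm_cis_le t. Qed.

Lemma lacunary_sumE n p : lacunary_sum n p =
  series (lacunary_term cos p.1) n +i* series (lacunary_term sin p.1) n.
Proof.
rewrite /lacunary_sum; apply: eqc_ReIm; rewrite raddf_sum /= seriesEord;
  by apply: eq_bigr => m _; rewrite mul0r ?subr0 ?addr0.
Qed.

Lemma cmeasurable_lacunary_sum n : cmeasurable T2 (lacunary_sum n).
Proof.
have m1 (F : R -> R) : continuous F ->
    measurable_fun T2 (fun p : R * R => series (lacunary_term F p.1) n).
  move=> cF; under [X in measurable_fun _ X]eq_fun do rewrite seriesEord.
  apply: measurable_sum => m.
  apply: measurable_funM; first exact: measurable_cst.
  apply: (measurableT_comp (continuous_measurable_fun cF)).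
  apply: measurable_funM; first exact: measurable_cst.
  exact: measurable_funTS measurable_fst.
split; under [X in measurable_fun _ X]eq_fun do rewrite lacunary_sumE /=.
- exact: m1 (@continuous_cos R).
- exact: m1 (@continuous_sin R).
Qed.

(** The partial sums converge uniformly, which gives measurability, square
    integrability and the Fourier coefficients of the limit. *)
Lemma lacunary_dist n p :
  `|complex.Re (lacunary p - lacunary_sum n p)| <= 2 * 2^-1 ^+ n /\
  `|complex.Im (lacunary p - lacunary_sum n p)| <= 2 * 2^-1 ^+ n.
Proof.
rewrite lacunary_sumE Re_addc Im_addc Re_oppc Im_oppc /=; split.
- by case: (dyadic_series (fun m => lacunary_term_le p.1 m norm_cos_le1)).
- by case: (dyadic_series (fun m => lacunary_term_le p.1 m (@sin_max R))).
Qed.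

Lemma cmeasurable_lacunary : cmeasurable T2 lacunary.
Proof.
have m1 (F : R -> R) : (forall t, `|F t| <= 1) ->
    (forall n, measurable_fun T2 (fun p : R * R => series (lacunary_term F p.1) n)) ->
    measurable_fun T2 (fun p => limn (series (lacunary_term F p.1))).
  move=> F1 mF; apply: (measurable_fun_cvg mF) => p _.
  by case: (dyadic_series (fun m => lacunary_term_le p.1 m F1)).
split; apply: m1.
- exact: norm_cos_le1.
- move=> n; have [+ _] := cmeasurable_lacunary_sum n.
  by under [X in measurable_fun _ X]eq_fun do rewrite lacunary_sumE /=.
- exact: (@sin_max R).
- move=> n; have [_ +] := cmeasurable_lacunary_sum n.
  by under [X in measurable_fun _ X]eq_fun do rewrite lacunary_sumE /=.
Qed.

Lemma lacunary_L2 : L2_T2 lacunary.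
Proof.
apply: (L2_T2_bounded (M := 2) cmeasurable_lacunary) => p.
have := lacunary_dist 0 p.
by rewrite /lacunary_sum big_ord0 subr0 expr0 mulr1.
Qed.

Lemma fourier_lacunary_sum n (k l : int) : fourier (lacunary_sum n) k l =
  \sum_(m < n) (2^-1 ^+ m *+ (((64 ^ m)%:Z == k) && (l == 0)))%:C.
Proof.
have pi2 : ((2 * pi : R) ^+ 2) != 0.
  by rewrite expf_neq0// mulf_neq0// gt_eqF// pi_gt0.
rewrite fourierE.
transitivity ((((2 * pi) ^+ 2)^-1)%:C * cintegral leb2 T2 (fun p =>
    \sum_(m < n) (2^-1 ^+ m)%:C *
      cis (((64 ^ m)%:Z - k)%:~R * p.1 + (- l)%:~R * p.2))).
  congr (_ * _); apply: eq_cintegral => p _.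
  rewrite mulr_suml; apply: eq_bigr => m _; rewrite -mulrA -cisD.
  by congr (_ * cis _); rewrite rmorphB rmorphN /= -pmulrn; ring.
have ic (m : 'I_n) : cintegrable leb2 T2 (fun p : R * R =>
    cis (((64 ^ m)%:Z - k)%:~R * p.1 + (- l)%:~R * p.2)).
  have := cintegrable_cis 0 (((64 ^ m)%:Z - k)%:~R : R) (- l)%:~R.
  by congr cintegrable; apply/funext => p; rewrite add0r.
rewrite cintegral_sum//; last by move=> m; exact: cintegrableZ.
rewrite mulr_sumr; apply: eq_bigr => m _.
rewrite cintegralZ// cintegral_cis mulrCA -rmorphM /= subr_eq0 oppr_eq0.
by case: (_ && _); rewrite ?mulr0n ?mulr1n ?mulr0 ?mulVf ?mulr1.
Qed.

(** Fourier coefficients depend continuously on the function for the sup norm,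
    so a coefficient that is eventually constant along the partial sums is the
    coefficient of the limit. *)
Lemma fourier_lacunary_eq (k l : int) (c : R[i]) (n0 : nat) :
  (forall n, (n0 <= n)%N -> fourier (lacunary_sum n) k l = c) ->
  fourier lacunary k l = c.
Proof.
move=> H.
have iL := L2_cintegrable lacunary_L2.
have small n : (n0 <= n)%N ->
    `|complex.Re (fourier lacunary k l - c)| <= 4 * 2^-1 ^+ n /\
    `|complex.Im (fourier lacunary k l - c)| <= 4 * 2^-1 ^+ n.
  move=> n0n.
  pose w p := lacunary p - lacunary_sum n p.
  have [L1 L2] := cmeasurable_lacunary; have [S1 S2] := cmeasurable_lacunary_sum n.
  have mw : cmeasurable T2 w.
    split.
    - under [X in measurable_fun _ X]eq_fun do rewrite Re_addc Re_oppc.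
      exact: measurable_funB.
    - under [X in measurable_fun _ X]eq_fun do rewrite Im_addc Im_oppc.
      exact: measurable_funB.
  have iw := L2_cintegrable (L2_T2_bounded mw (lacunary_dist n)).
  have iS : cintegrable leb2 T2 (lacunary_sum n).
    have := cintegrableD mT2 iL (cintegrableZ mT2 (-1) iw).
    by apply: (eq_cintegrable mT2) => p _; rewrite /w; ring.
  have -> : fourier lacunary k l - c = fourier w k l.
    have wE : lacunary = w \+ lacunary_sum n.
      by apply/funext => p; rewrite /w /= subrK.
    by rewrite {1}wE fourierD// (H n n0n) addrK.
  have := fourier_le_sup k l mw (lacunary_dist n).
  by rewrite mulrA -natrM.
have z (x : R) : (forall n, (n0 <= n)%N -> `|x| <= 4 * 2^-1 ^+ n) -> x = 0.
  move=> xn; apply/eqP; rewrite -normr_le0.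
  have c0 : 4 * 2^-1 ^+ n @[n --> \oo] --> (0 : R).
    rewrite -[X in _ --> X](mulr0 4); apply: cvgM; first exact: cvg_cst.
    by apply: cvg_expr; rewrite ger0_norm// invf_lt1// ltr1n.
  rewrite -(cvg_lim _ c0)//; apply: limr_ge; first by apply/cvg_ex; eexists; exact: c0.
  by near=> n; apply: xn; near: n; exact: nbhs_infty_ge.
apply/eqP; rewrite -subr_eq0; apply/eqP; apply: eqc_ReIm; apply: z => n /small[] //.
Unshelve. all: by end_near.
Qed.

Lemma fourier_lacunary (m : nat) (l : int) :
  fourier lacunary (64 ^ m)%:Z l = (2^-1 ^+ m *+ (l == 0))%:C.
Proof.
apply: (@fourier_lacunary_eq _ _ _ m.+1) => n mn.
rewrite fourier_lacunary_sum (bigD1 (Ordinal mn))//= eqxx/= big1 ?addr0//.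
move=> j jm; rewrite eqz_nat eqn_exp2l//.
by rewrite (_ : (j == m :> nat) = false)//; apply: negbTE.
Qed.

(** No frequency [64^m] is 0: the function has mean zero in x. *)
Lemma fourier_lacunary0 (l : int) : fourier lacunary 0 l = 0.
Proof.
apply: (@fourier_lacunary_eq _ _ _ 0) => n _.
rewrite fourier_lacunary_sum big1// => j _.
by rewrite eqz_nat expn_eq0.
Qed.

End Lacunary.

(** * The control operator against a test function *)

Section Control.
Variable R : realType.
Local Notation T1 := (@Defs.T1 R).
Local Notation T2 := (@Defs.T2 R).
Local Notation leb1 := (leb1 R).
Local Notation leb2 := (leb2 R).
Let mT2 := @measurable_T2 R.
Let mT1 := @measurable_T1 R.

Variables (g : R -> R) (M : R).
Hypothesis mg : measurable_fun T1 g.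
Hypothesis gM : forall y, T1 y -> 0 <= g y <= M.

Let mg2 : measurable_fun T2 (fun p : R * R => g p.2).
Proof.
apply: (@measurable_comp _ _ _ _ _ _ T1 g) => //.
  by move=> _ [p [_ Tp] <-].
exact: measurable_funTS measurable_snd.
Qed.

Let g_norm (p : R * R) : T2 p -> `|g p.2| <= M.
Proof. by move=> [_ /gM /andP[g0 g1]]; rewrite ger0_norm. Qed.

Lemma weighted_marginal (r : R * R -> R)
    (H := fun x => Rintegral leb1 T1 (fun y => g y * r (x, y))) :
  leb2.-integrable T2 (EFin \o r) ->
  leb2.-integrable T2 (EFin \o (fun p => H p.1)) /\
  Rintegral leb2 T2 (fun p => `|H p.1|) <=
    2 * pi * M * Rintegral leb2 T2 (fun p => `|r p|).
Proof.
move=> ir.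
have mr : measurable_fun T2 r by apply/measurable_EFinP; exact: measurable_int ir.
have igr : leb2.-integrable T2 (EFin \o (fun p => g p.2 * r p)).
  apply: (le_integrable mT2 _ _ (integrableZl mT2 M ir)).
    by apply/measurable_EFinP; exact: measurable_funM.
  move=> p Tp /=; rewrite lee_fin !normrM ler_wpM2r//.
  by rewrite (le_trans (g_norm Tp))// ler_norm.
have T1oo : (leb1 T1 < +oo)%E by rewrite leb1_T1 ltey.
have [iH leH] := @marginal_integral _ _ _ _ R leb1 leb1 T1 T1 mT1 mT1 _ T1oo igr.
split=> //.
have fH : (\int[leb2]_(p in T2) (`|H p.1|)%:E)%E \is a fin_num.
  exact: (integrable_fin_num mT2 (integrable_norm iH)).
have fr : (\int[leb2]_(p in T2) (`|g p.2 * r p|)%:E)%E \is a fin_num.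
  exact: (integrable_fin_num mT2 (integrable_norm igr)).
have {}leH : Rintegral leb2 T2 (fun p => `|H p.1|) <=
    2 * pi * Rintegral leb2 T2 (fun p => `|g p.2 * r p|).
  rewrite -lee_fin EFinM /Rintegral !fineK//.
  by move: leH; rewrite [X in (X * _)%E]leb1_T1.
rewrite (le_trans leH)// -[leRHS]mulrA ler_wpM2l ?mulr_ge0 ?pi_ge0//.
rewrite -(RintegralZl M mT2 (integrable_norm ir)).
apply: (le_Rintegral mT2).
- exact: (integrable_norm igr).
- exact: (integrableZl mT2 M (integrable_norm ir)).
- by move=> p Tp; rewrite normrM ler_wpM2r// g_norm.
Qed.

(** Both terms of the control operator carry the factor [g y], so what matters
    about Q is the size e of [g Q]. The other factor is h minus its weighted
    mean in y, whose L^1 norm is controlled by [weighted_marginal]. *)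
Lemma control_op_bound (h : R * R -> R[i]) : L2_T2 h ->
  cintegrable leb2 T2 (control_op g h) /\
  forall (Q : R * R -> R[i]) (B e : R), cmeasurable T2 Q ->
    (forall p, `|complex.Re (Q p)| <= B /\ `|complex.Im (Q p)| <= B) ->
    (forall p, T2 p -> `|g p.2 * complex.Re (Q p)| <= e /\
                       `|g p.2 * complex.Im (Q p)| <= e) ->
    `|complex.Re (cintegral leb2 T2 (fun p => control_op g h p * Q p))| <=
      e * (2 * (1 + 2 * pi * M) * ((2 * pi) ^+ 2 + fine (sqnorm_T2 h))).
Proof.
move=> h2; have [ihR ihI] := L2_cintegrable h2.
have [hRS hIS] := Rintegral_norm_ReIm_le h2.
pose HR x := Rintegral leb1 T1 (fun y => g y * complex.Re (h (x, y))).
pose HI x := Rintegral leb1 T1 (fun y => g y * complex.Im (h (x, y))).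
have [iHR leHR] := weighted_marginal ihR.
have [iHI leHI] := weighted_marginal ihI.
rewrite -/HR in iHR leHR; rewrite -/HI in iHI leHI.
pose D p := h p - (HR p.1 +i* HI p.1).
have cE p : control_op g h p = D p * (g p.2)%:C.
  rewrite /control_op mulrC; congr ((_ - _) * _); apply: eqc_ReIm => /=;
    by apply: eq_Rintegral => y _; rewrite ?Re_mulc ?Im_mulc /= mul0r ?subr0 ?addr0.
have iD : cintegrable leb2 T2 D.
  apply: (cintegrableD mT2 (conj ihR ihI)).
  have := @cintegrableZ _ _ _ leb2 T2 mT2 (-1) _ (conj iHR iHI :
    cintegrable leb2 T2 (fun p => HR p.1 +i* HI p.1)).
  by apply: (eq_cintegrable mT2) => p _; rewrite mulN1r.
have iC : cintegrable leb2 T2 (control_op g h).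
  apply: (eq_cintegrable mT2 (fun p _ => esym (cE p))).
  apply: (@cintegrable_bounded_mul _ _ _ _ _ mT2 _ _ M iD).
    by split => //=; exact: measurable_cst.
  move=> p Tp /=; split; first exact: g_norm.
  by rewrite normr0 (le_trans _ (g_norm Tp)).
split=> // Q B e mQ QB Qe.
have [iCQ _] := cintegrable_bounded_mul mT2 iC mQ (fun p _ => QB p).
have M0 : 0 <= M.
  have /gM/andP[] : T1 0 by rewrite /Defs.T1 /= in_itv/= lexx mulr_gt0 ?pi_gt0.
  exact: le_trans.
have e0 : 0 <= e.
  have /Qe[+ _] : T2 (0, 0) by split; rewrite /Defs.T1 /= in_itv/= lexx mulr_gt0 ?pi_gt0.
  exact: le_trans.
pose G p := `|complex.Re (h p)| + `|HR p.1| + (`|complex.Im (h p)| + `|HI p.1|).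
have iG1 := integrableD mT2 (integrable_norm ihR) (integrable_norm iHR).
have iG2 := integrableD mT2 (integrable_norm ihI) (integrable_norm iHI).
have iG : leb2.-integrable T2 (EFin \o G) by exact: (integrableD mT2 iG1 iG2).
rewrite /= (le_trans (le_normr_Rintegral mT2 iCQ))//.
apply: (@le_trans _ _ (Rintegral leb2 T2 (fun p => e * G p))).
  apply: (le_Rintegral mT2).
  - exact: (integrable_norm iCQ).
  - exact: (integrableZl mT2 e iG).
  - move=> p Tp; rewrite cE -mulrA Re_mulc Re_mulc Im_mulc /= !mul0r subr0 addr0.
    have [q1 q2] := Qe p Tp.
    rewrite (le_trans (ler_normB _ _))// !normrM -!normrM mulrDr lerD//.
    + rewrite normrM mulrC ler_pM// /D Re_addc Re_oppc /=.
      by rewrite (le_trans (ler_normB _ _)).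
    + rewrite normrM mulrC ler_pM// /D Im_addc Im_oppc /=.
      by rewrite (le_trans (ler_normB _ _)).
rewrite (RintegralZl e mT2 iG) ler_wpM2l//.
rewrite /G (RintegralD mT2 iG1 iG2).
rewrite (RintegralD mT2 (integrable_norm ihR) (integrable_norm iHR)).
rewrite (RintegralD mT2 (integrable_norm ihI) (integrable_norm iHI)).
have c0 : 0 <= 2 * pi * M by rewrite !mulr_ge0 ?pi_ge0.
have := ler_wpM2l c0 hRS; have := ler_wpM2l c0 hIS.
move: leHR leHI hRS hIS.
set a := Rintegral _ _ _; set b := Rintegral _ _ _.
set a' := Rintegral _ _ _; set b' := Rintegral _ _ _.
set s := _ + fine _; set c := 2 * pi * M.
move=> *; rewrite (_ : 2 * (1 + c) * s = (s + c * s) + (s + c * s)); last by ring.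
lra.
Qed.

End Control.

(** * Test functions and their evolution *)

Section TestFunction.
Variable R : realType.
Local Notation T2 := (@Defs.T2 R).
Local Notation leb2 := (leb2 R).
Let mT2 := @measurable_T2 R.
Variables (c : R) (k N : nat).

Definition test_freq (j : 'I_N.*2.+1) : int := j%:Z - N%:Z.

(** Weights of the profile centred at c. *)
Definition test_coef (j : 'I_N.*2.+1) : R[i] :=
  (bin_weight R N j)%:C * cis ((j%:R - N%:R) * c).

Definition evolved_coef (t : R) (j : 'I_N.*2.+1) : R[i] :=
  test_coef j * cexp (t%:C * kp_symbol R k%:Z (test_freq j)).

(** At [t = 0] this is [e^{-ikx} ((1 + cos (c - y)) / 2)^N]; for larger t its
    coefficients are multiplied by those of the group at time t. *)
Definition evolved_test (t : R) (p : R * R) : R[i] :=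
  \sum_(j < N.*2.+1) evolved_coef t j * mode k%:Z (test_freq j) p.

Lemma evolved_testE t p : evolved_test t p = \sum_(j < N.*2.+1)
  (bin_weight R N j)%:C *
  cis (t * k%:R ^+ 3 - k%:R * p.1 + (j%:R - N%:R) * (c - p.2) +
       - (t * (j%:R - N%:R) ^+ 2 / k%:R)).
Proof.
apply: eq_bigr => j _.
rewrite /evolved_coef /test_coef cexp_symbol /mode -!mulrA -!cisD.
by congr (_ * cis _); rewrite rmorphB /= -!pmulrn; ring.
Qed.

Lemma evolved_test0 p : evolved_test 0 p =
  \sum_(j < N.*2.+1) test_coef j * mode k%:Z (test_freq j) p.
Proof.
by apply: eq_bigr => j _; rewrite /evolved_coef cexp_symbol mul0r cis0 mulr1.
Qed.

(** In the exponent of [evolved_testE] the terms [t k^3 - k x] are common to all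
    summands and leave the bound unchanged, and [|l| <= N] makes the remaining
    dispersion [t l^2 / k] at most [T N^2 / k]. *)
Lemma evolved_test_le (T t : R) p : 0 <= t <= T ->
  `|complex.Re (evolved_test t p)| <=
    ((1 + cos (c - p.2)) / 2) ^+ N + T * N%:R ^+ 2 / k%:R /\
  `|complex.Im (evolved_test t p)| <=
    ((1 + cos (c - p.2)) / 2) ^+ N + T * N%:R ^+ 2 / k%:R.
Proof.
move=> /andP[t0 tT]; rewrite evolved_testE; apply: perturbed_bin_weight_le => j.
rewrite normrN ger0_norm; last first.
  by apply: mulr_ge0; [apply: mulr_ge0; rewrite ?sqr_ge0|rewrite invr_ge0].
rewrite ler_wpM2r ?invr_ge0// ler_pM ?sqr_ge0//.
rewrite -[X in X <= _]real_normK ?num_real// ler_pXn2r ?nnegrE//.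
have h1 : (j%:R : R) <= N%:R + N%:R by rewrite -natrD ler_nat addnn -ltnS.
have h2 : (0 : R) <= j%:R by [].
by rewrite ler_norml; apply/andP; split; lra.
Qed.

Lemma evolved_test_bounded (T t : R) p : 0 <= t <= T ->
  `|complex.Re (evolved_test t p)| <= 1 + T * N%:R ^+ 2 / k%:R /\
  `|complex.Im (evolved_test t p)| <= 1 + T * N%:R ^+ 2 / k%:R.
Proof.
move=> /(evolved_test_le p)[h1 h2].
have r1 : ((1 + cos (c - p.2)) / 2) ^+ N <= 1.
  have := cos_geN1 (c - p.2); have := cos_le1 (c - p.2) => *.
  by rewrite exprn_ile1//; lra.
by split; [apply: le_trans h1 _|apply: le_trans h2 _]; rewrite lerD2r.
Qed.

Lemma cmeasurable_evolved_test t : cmeasurable T2 (evolved_test t).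
Proof.
have [] : cintegrable leb2 T2 (evolved_test t).
  apply: cintegrable_sum => // j; apply: cintegrableZ => //.
  exact: (L2_cintegrable (@L2_T2_bounded _ _ 1 (cmeasurable_mode _ _ _)
    (fun p => norm_cis_le _))).
by move=> /measurable_int/measurable_EFinP ? /measurable_int/measurable_EFinP ?.
Qed.

(** Duality: the group at time t, moved from w onto the test function. *)
Lemma cintegral_test_evolved (t : R) (v w : R * R -> R[i]) :
  cintegrable leb2 T2 v -> cintegrable leb2 T2 w ->
  (forall k l : int, fourier w k l = cexp (t%:C * kp_symbol R k l) * fourier v k l) ->
  cintegral leb2 T2 (fun p => w p * evolved_test 0 p) =
  cintegral leb2 T2 (fun p => v p * evolved_test t p).
Proof.
move=> iv iw wv.
transitivity (cintegral leb2 T2 (fun p => w p *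
    \sum_(j < N.*2.+1) test_coef j * mode k%:Z (test_freq j) p)).
  by apply: eq_cintegral => p _; rewrite evolved_test0.
rewrite !cintegral_trig_poly//; congr (_ * _); apply: eq_bigr => j _.
by rewrite wv mulrA.
Qed.

End TestFunction.

(** The lacunary function does not depend on y, so only the central weight, at
    y-frequency 0, contributes. *)
Lemma cintegral_test_lacunary (R : realType) (c : R) (m N : nat)
    (w : R * R -> R[i]) : cintegrable (leb2 R) (@T2 R) w ->
  (forall k l : int, fourier w k l = fourier (@lacunary R) k l) ->
  cintegral (leb2 R) (@T2 R) (fun p => w p * evolved_test c (64 ^ m) N 0 p) =
  ((2 * pi) ^+ 2 * (bin_weight R N N * 2^-1 ^+ m))%:C.
Proof.
move=> iw wl.
transitivity (cintegral (leb2 R) (@T2 R) (fun p => w p *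
    \sum_(j < N.*2.+1) test_coef c j * mode (64 ^ m)%:Z (test_freq j) p)).
  by apply: eq_cintegral => p _; rewrite evolved_test0.
rewrite cintegral_trig_poly// [RHS]rmorphM; congr (_ * _).
have NN : (N < N.*2.+1)%N by rewrite ltnS -addnn leq_addr.
rewrite (bigD1 (Ordinal NN))//= big1 ?addr0.
  rewrite wl fourier_lacunary /test_freq /= subrr eqxx mulr1n /test_coef /=.
  by rewrite subrr mul0r cis0 mulr1 -rmorphM.
move=> j jN; rewrite wl fourier_lacunary /test_freq subr_eq0 eqz_nat.
by rewrite (_ : (j == N :> nat) = false) ?mulr0n ?mulr0//; apply: negbTE.
Qed.

Lemma ae_imply2 d (X : measurableType d) (R : realType)
    (m : {measure set X -> \bar R}) (P Q S : X -> Prop) :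
  (forall x, P x -> Q x -> S x) -> {ae m, forall x, P x} ->
  {ae m, forall x, Q x} -> {ae m, forall x, S x}.
Proof. by move=> PQ; exact: filterS2. Qed.

Lemma measurable_sqnorm (R : realType) (T : R) (h : R -> R * R -> R[i]) :
  cmeasurable (`]0, T[%classic `*` @T2 R)
    (fun z : R * (R * R) => h z.1 z.2) ->
  measurable_fun (`]0, T[%classic : set R) (fun t => sqnorm_T2 (h t)).
Proof.
move=> mh; set I : set R := `]0, T[%classic.
pose F (z : R * (R * R)) : \bar R := (Normc.normc (h z.1 z.2) ^+ 2)%:E.
have mI : measurable (I : set (measurableTypeR R)) by exact: measurable_itv.
have mIT := measurableX mI (@measurable_T2 R).
have mF : measurable_fun (I `*` @T2 R) F.
  by apply/measurable_EFinP; exact: measurable_sqr_normc mh.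
move: mF => /(measurable_restrictT F mIT) mF.
have F0 z : (0 <= (F \_ (I `*` @T2 R)) z)%E.
  by rewrite patchE; case: ifP => // _; rewrite lee_fin sqr_ge0.
have := @measurable_integral_prod _ _ _ (measurableTypeR R) (measurableTypeR R)
  (measurableTypeR R) R (leb1 R) (leb1 R) _ mF F0.
move=> /(measurable_funTS (D := I)); apply: eq_measurable_fun => t /[!inE] It.
rewrite /sqnorm_T2 [RHS]integral_mkcond; apply: eq_integral => p _.
rewrite !patchE in_setX /= mem_set//.
Qed.

(** * Reachable states *)

Section Observability.
Variable R : realType.
Local Notation T1 := (@Defs.T1 R).
Local Notation T2 := (@Defs.T2 R).
Local Notation leb1 := (leb1 R).
Local Notation leb2 := (leb2 R).
Let mT2 := @measurable_T2 R.

Variables (g : R -> R) (M q c T : R).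
Hypothesis mg : measurable_fun T1 g.
Hypothesis gM : forall y, T1 y -> 0 <= g y <= M.
Hypothesis q0 : 0 <= q.
Hypothesis gq : forall y, T1 y -> 0 < g y -> (1 + cos (c - y)) / 2 <= q.
Hypothesis T0 : 0 < T.

Let M0 : 0 <= M.
Proof.
have /gM/andP[] : T1 0 by rewrite /Defs.T1 /= in_itv/= lexx mulr_gt0 ?pi_gt0.
exact: le_trans.
Qed.

Let A0 : 0 <= 2 * (1 + 2 * pi * M).
Proof. by rewrite mulr_ge0// addr_ge0// !mulr_ge0// pi_ge0. Qed.

Let disp0 (k N : nat) : 0 <= T * N%:R ^+ 2 / k%:R.
Proof. by apply: mulr_ge0; [apply: mulr_ge0; rewrite ?sqr_ge0 ?ltW|rewrite invr_ge0]. Qed.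

(** Where g vanishes the product with the test function vanishes; where it does
    not, the point lies in the strip and the profile is at most [q^N]. *)
Lemma control_test_le (k N : nat) (t : R) (h : R * R -> R[i]) :
  0 <= t <= T -> L2_T2 h ->
  `|complex.Re (cintegral leb2 T2
      (fun p => control_op g h p * evolved_test c k N t p))| <=
  M * (q ^+ N + T * N%:R ^+ 2 / k%:R) *
  (2 * (1 + 2 * pi * M) * ((2 * pi) ^+ 2 + fine (sqnorm_T2 h))).
Proof.
move=> tT h2; have [_] := control_op_bound mg gM h2.
apply; first exact: cmeasurable_evolved_test.
  by move=> p; exact: (evolved_test_bounded c k N p tT).
move=> p [Tp1 Tp2]; have [h1 h3] := evolved_test_le c k N p tT.
have eps0 := disp0 k N.
have /andP[g0 g1] := gM Tp2.
have [gz|gpos] := eqVneq (g p.2) 0.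
  rewrite gz !mul0r normr0; split; apply: mulr_ge0 => //; apply: addr_ge0 => //;
  exact: exprn_ge0.
have {}gpos : 0 < g p.2 by rewrite lt_neqAle eq_sym gpos.
have rq := gq Tp2 gpos.
have r0 : 0 <= (1 + cos (c - p.2)) / 2.
  by rewrite divr_ge0//; have := cos_geN1 (c - p.2); lra.
have rN : ((1 + cos (c - p.2)) / 2) ^+ N <= q ^+ N by rewrite lerXn2r ?nnegrE.
rewrite !normrM (ger0_norm g0).
by split; rewrite ler_pM// ?(le_trans h1) ?(le_trans h3)// lerD2r.
Qed.

(** The Duhamel term w of a solution that reaches [v0 + lacunary] has the
    Fourier coefficients of [lacunary], since the free part v has those of
    [v0]. Its pairing with the test function is computed from these
    coefficients on one side and bounded through the control on the other. *)
Lemma reachable_lacunary_le (u0 v0 : R * R -> R[i]) (h u : R -> R * R -> R[i])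
    (m N : nat) :
  kp_group T u0 v0 -> L2_time_L20 T h ->
  mild_solution T u0 (fun t => control_op g (h t)) u ->
  eq_T2 (u T) (v0 \+ @lacunary R) ->
  (2 * pi) ^+ 2 * (bin_weight R N N * 2^-1 ^+ m) <=
  M * (q ^+ N + T * N%:R ^+ 2 / (64 ^ m)%:R) *
  (2 * (1 + 2 * pi * M) * ((2 * pi) ^+ 2 * T +
     fine (\int[leb1]_(t in `]0%R, T[) sqnorm_T2 (h t))%E)).
Proof.
move=> [v0L v0E] [mh hL hfin] [_ /(_ T)].
have TT : `[0, T]%classic T by rewrite /= in_itv/= lexx ltW.
move=> /(_ TT) [v [w [F [[vL vE] FE [w2 wF] uT]]]] uT1.
have iv := L2_cintegrable vL.1; have iv0 := L2_cintegrable v0L.1.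
have iw := L2_cintegrable w2; have il := L2_cintegrable (@lacunary_L2 R).
have wE (k l : int) : fourier w k l = fourier (@lacunary R) k l.
  have vw : eq_T2 (v \+ w) (v0 \+ @lacunary R).
    by apply: (@ae_imply2 _ _ _ leb2 _ _ _ _ uT uT1) => p e1 e2 Tp;
       rewrite -(e1 Tp) -(e2 Tp).
  have := eq_fourier k l (cintegrableD mT2 iv iw) (cintegrableD mT2 iv0 il) vw.
  by rewrite !fourierD// vE v0E => /addrI.
set k := (64 ^ m)%N.
pose P := @evolved_test R c k N 0.
(* inner_T2 conjugates its second argument. *)
pose phi p := conjc (P p).
have phi2 : L2_T2 phi.
  have [m1 m2] := @cmeasurable_evolved_test R c k N 0.
  have T00 : (0 : R) <= 0 <= T by rewrite lexx ltW.
  have PB p := evolved_test_bounded c k N p T00.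
  apply: (@L2_T2_bounded R _ (1 + T * N%:R ^+ 2 / k%:R)).
    split.
    - by move: m1; apply: eq_measurable_fun => p _; rewrite /phi /P; case: evolved_test.
    - have := measurable_funN m2; apply: eq_measurable_fun => p _.
      by rewrite /phi /P /=; case: evolved_test.
  move=> p; have [] := PB p.
  by rewrite /phi -/P; case: (P p) => x y /=; rewrite normrN.
have innerE (z : R * R -> R[i]) :
    inner_T2 z phi = cintegral leb2 T2 (fun p => z p * P p).
  by apply: eq_cintegral => p _; rewrite /phi conjcK.
have [[iF _]] := wF _ phi2.
have wP : cintegral leb2 T2 (fun p => w p * P p) =
    ((2 * pi) ^+ 2 * (bin_weight R N N * 2^-1 ^+ m))%:C.
  exact: (cintegral_test_lacunary c m N iw wE).
rewrite innerE wP => /(congr1 (@complex.Re R)) /= mainE.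
rewrite mainE.
have mI : measurable (`]0, T[%classic : set (measurableTypeR R)) by exact: measurable_itv.
rewrite (le_trans (ler_norm _))// (le_trans (le_normr_Rintegral mI iF))//.
pose C := M * (q ^+ N + T * N%:R ^+ 2 / k%:R) * (2 * (1 + 2 * pi * M)).
have C0 : 0 <= C.
  by apply: mulr_ge0 => //; apply: mulr_ge0 => //; rewrite addr_ge0// exprn_ge0.
have msq := measurable_sqnorm mh.
pose f2 t : \bar R := (C%:E * (((2 * pi) ^+ 2)%:E + sqnorm_T2 (h t)))%E.
have sq0 t : (0 <= sqnorm_T2 (h t))%E.
  by apply: integral_ge0 => p _; rewrite lee_fin sqr_ge0.
have f20 t : (0 <= f2 t)%E.
  by rewrite mule_ge0// adde_ge0// lee_fin sqr_ge0.
have mf2 : measurable_fun (`]0, T[%classic : set (measurableTypeR R)) f2.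
  apply: emeasurable_funM; first exact: measurable_cst.
  by apply: emeasurable_funD => //; exact: measurable_cst.
have leF : {ae leb1, forall s, `]0, T[%classic s ->
    ((`|complex.Re (inner_T2 (F s) phi)|)%:E <= f2 s)%E}.
  apply: (@ae_imply2 _ _ _ leb1 _ _ _ _ FE hL) => s FEs hLs sT.
  have [[F2 _] FsE] := FEs sT; have [hs2 _] := hLs sT.
  have tT : 0 <= T - s <= T.
    by move: sT; rewrite /= in_itv/= => /andP[s0 s1]; apply/andP; split; lra.
  have [iK _] := control_op_bound mg gM hs2.
  (* F s is the image of the control at time s under the group at time T - s. *)
  rewrite innerE /P.
  rewrite (cintegral_test_evolved c k N (t := T - s) iK (L2_cintegrable F2) FsE).
  have fin : sqnorm_T2 (h s) \is a fin_num by rewrite ge0_fin_numE//; case: hs2.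
  rewrite /f2 -(fineK fin) -EFinD -EFinM lee_fin /C -[leRHS]mulrA.
  exact: control_test_le.
have mF : measurable_fun (`]0, T[%classic : set (measurableTypeR R))
    (fun s => (`|complex.Re (inner_T2 (F s) phi)|)%:E).
  exact: (measurable_int _ (integrable_norm iF)).
have F0 s : `]0, T[%classic s ->
    (0 <= (`|complex.Re (inner_T2 (F s) phi)|)%:E)%E by rewrite lee_fin.
have := ae_ge0_le_integral mI F0 mF (fun s _ => f20 s) mf2 leF.
have -> : (\int[leb1]_(s in `]0%R, T[) f2 s =
  (C * ((2 * pi) ^+ 2 * T + fine (\int[leb1]_(t in `]0%R, T[) sqnorm_T2 (h t))))%:E)%E.
  rewrite ge0_integralZl//; last 2 first.
  - by apply: emeasurable_funD => //; exact: measurable_cst.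
  - by move=> t _; rewrite adde_ge0// lee_fin sqr_ge0.
  rewrite ge0_integralD//; last first.
    by move=> t _; rewrite lee_fin sqr_ge0.
  rewrite integral_cst//= lebesgue_measure_itv/= lte_fin T0 oppr0 adde0.
  rewrite [RHS]EFinM EFinD [X in (_ = _ * (X + _))%E]EFinM fineK//.
  by rewrite ge0_fin_numE//; exact: integral_ge0.
move=> le.
rewrite -lee_fin /Rintegral fineK; last first.
  exact: (integrable_fin_num mI (integrable_norm iF)).
rewrite [X in (_ <= X%:E)%E]mulrA -/C.
exact: le.
Qed.

End Observability.

(** With [q^p <= 1/16] and [N = p m], both [q^N] and [T N^2 / 64^m] are
    [O(16^{-m})], because [m <= 2^m] and [64^m = 4^m 16^m]; the factor
    [2N + 1] lost in [bin_weight_mid] is [O(2^m)]. The hypothesis then reads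
    [2^{-m} = O(8^{-m})]. *)
Lemma lacunary_contradiction (R : realType) (q M T S : R) :
  0 <= q < 1 -> 0 <= M -> 0 < T -> 0 <= S ->
  (forall m N : nat, (2 * pi) ^+ 2 * (bin_weight R N N * 2^-1 ^+ m) <=
     M * (q ^+ N + T * N%:R ^+ 2 / (64 ^ m)%:R) * S) -> False.
Proof.
move=> /andP[q0 q1] M0 T0 S0 H.
have [p qp] : exists p : nat, q ^+ p <= 16^-1.
  have cq : q ^+ n @[n --> \oo] --> (0 : R) by apply: cvg_expr; rewrite ger0_norm.
  have e0 : 0 < 16^-1 :> R by rewrite invr_gt0 ltr0n.
  move/cvgrPdist_le : cq => /(_ _ e0)[p _ /(_ p)] /= hp.
  by exists p; rewrite -[leLHS]ger0_norm ?exprn_ge0// -normrN -sub0r hp.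
pose K := M * S * (2 * p%:R + 1) * (1 + T * p%:R ^+ 2).
have pR : (0 : R) <= p%:R by [].
have K0 : 0 <= K.
  rewrite /K; apply: mulr_ge0; first apply: mulr_ge0; first exact: mulr_ge0.
    by rewrite addr_ge0// mulr_ge0.
  by rewrite addr_ge0// mulr_ge0 ?sqr_ge0 ?ltW.
have pi0 : 0 < (2 * pi : R) ^+ 2 by rewrite exprn_gt0// mulr_gt0// pi_gt0.
have key (m : nat) : (2 * pi) ^+ 2 * 4 ^+ m <= K.
  pose N := (p * m)%N.
  have N0 : (0 : R) < N.*2.+1%:R by [].
  have m2 : (m%:R : R) <= 2 ^+ m by rewrite -natrX ler_nat ltnW// ltn_expl.
  have x0 : (0 : R) < 2 ^+ m by rewrite exprn_gt0.
  have Nle : (N%:R : R) <= p%:R * 2 ^+ m by rewrite natrM ler_wpM2l.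
  have N1 : (N.*2.+1%:R : R) <= (2 * p%:R + 1) * 2 ^+ m.
    have x1 : (1 : R) <= 2 ^+ m by rewrite exprn_ege1// ler1n.
    by rewrite -addn1 -addnn !natrD; nra.
  have qN : q ^+ N <= (2 ^+ m) ^- 4.
    rewrite /N exprM (le_trans (lerXn2r m _ _ qp)) ?nnegrE ?exprn_ge0 ?invr_ge0//.
    by rewrite exprVn -exprM mulnC exprM (_ : 2 ^+ 4 = 16 :> R)//; ring.
  have dN : T * N%:R ^+ 2 / (64 ^ m)%:R <= T * p%:R ^+ 2 * (2 ^+ m) ^- 4.
    have -> : ((64 ^ m)%:R : R) = (2 ^+ m) ^+ 6.
      by rewrite natrX -exprM mulnC exprM (_ : 2 ^+ 6 = 64%:R :> R)//; ring.
    set x := 2 ^+ m in x0 Nle *.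
    rewrite ler_pdivrMr ?exprn_gt0//.
    rewrite (_ : _ * x ^+ 6 = T * (p%:R * x) ^+ 2); last by field; rewrite gt_eqF.
    rewrite ler_wpM2l ?(ltW T0)// lerXn2r ?nnegrE//.
    by rewrite mulr_ge0// ltW.
  have bw := bin_weight_mid R N.
  have h := H m N; set x := (2 : R) ^+ m in x0 Nle N1 qN dN *.
  have x6 : 0 <= x ^- 4 by rewrite invr_ge0 exprn_ge0// ltW.
  have h1 : (2 * pi) ^+ 2 * (N.*2.+1%:R^-1 * x^-1) <=
      M * (x ^- 4 * (1 + T * p%:R ^+ 2)) * S.
    rewrite (le_trans _ (le_trans h _))//.
      by rewrite ler_wpM2l ?(ltW pi0)// /x exprVn ler_wpM2r// invr_ge0 ltW.
    rewrite ler_wpM2r// ler_wpM2l// mulrDr mulr1 lerD//.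
    by rewrite [leRHS]mulrC.
  have -> : (4 : R) ^+ m = x ^+ 2.
    by rewrite /x -exprM mulnC exprM (_ : 2 ^+ 2 = 4 :> R)//; ring.
  have y0 : 0 <= M * S * (1 + T * p%:R ^+ 2).
    by rewrite !mulr_ge0// addr_ge0// mulr_ge0 ?sqr_ge0 ?ltW.
  have h2 : (2 * pi) ^+ 2 * x ^+ 3 <=
      M * S * (1 + T * p%:R ^+ 2) * N.*2.+1%:R.
    have := ler_wpM2l (ltW (mulr_gt0 N0 (exprn_gt0 4 x0))) h1.
    rewrite (_ : _ * (_ * (_^-1 * _)) = (2 * pi) ^+ 2 * x ^+ 3); last first.
      by field; rewrite !gt_eqF.
    by rewrite (_ : _ * (M * _ * S) = M * S * (1 + T * p%:R ^+ 2) * N.*2.+1%:R)//;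
       field; rewrite gt_eqF.
  have h3 := ler_wpM2l y0 N1.
  rewrite -(ler_pM2r x0).
  rewrite (_ : K * x = M * S * (1 + T * p%:R ^+ 2) * ((2 * p%:R + 1) * x)); last first.
    by rewrite /K; ring.
  rewrite (_ : _ * x ^+ 2 * x = (2 * pi) ^+ 2 * x ^+ 3); last by ring.
  exact: le_trans h2 h3.
have [m Hm] : exists m : nat, K / (2 * pi) ^+ 2 < m%:R.
  by exists (Num.bound (K / (2 * pi) ^+ 2)); rewrite archi_boundP// divr_ge0// ltW.
have : K < (2 * pi) ^+ 2 * 4 ^+ m.
  rewrite mulrC -ltr_pdivrMr// (lt_le_trans Hm)//.
  by rewrite -natrX ler_nat ltnW// ltn_expl.
by rewrite ltNge key.
Qed.

Theorem theorem1p4 (R : realType) (a b : R) (g : R -> R)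
  (hab0 : 0 < b - a) (hab1 : b - a < 2 * pi)
  (gC2 : C2_periodic g)
  (g_ge0 : forall y, 0 <= g y)
  (g_supp : forall y, 0 < g y <->
     exists n : int, a < y + n%:~R * (2 * pi) < b)
  (g_int : (\int[@lebesgue_measure R]_(y in @T1 R) (g y)%:E = 1)%E)
  (T : R) (hT : 0 < T)
  (u0 : R * R -> R[i]) (hu0 : L20 u0) :
  exists u1 : R * R -> R[i], L20 u1 /\
    ~ exists h : R -> R * R -> R[i], L2_time_L20 T h /\
        exists u : R -> R * R -> R[i],
          mild_solution T u0 (fun t => control_op g (h t)) u /\
          eq_T2 (u T) u1.
Proof.
have cg : continuous g.
  case: gC2 => _ dg _ _ y.
  exact/differentiable_continuous/derivable1_diffP.
have [M gM] : exists M, forall y, @T1 R y -> 0 <= g y <= M.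
  have pi0 : 0 <= 2 * pi :> R by rewrite mulr_ge0 ?pi_ge0.
  have [y _ gy] := EVT_max pi0 (continuous_subspaceT cg).
  exists (g y) => z; rewrite /Defs.T1 /= in_itv/= => /andP[z0 z1].
  by rewrite g_ge0 gy// in_itv/= z0 ltW.
have mg : measurable_fun (@T1 R) g.
  exact: measurable_funTS (continuous_measurable_fun cg).
(* If no function has the Fourier coefficients of the free evolution of u0 at
   time T, then u0 has no mild solution at all, and even 0 is not reached. *)
have [[v0 hv0]|nov] := pselect (exists v0, kp_group T u0 v0); last first.
  exists (fun=> 0); split.
    split; first by apply: (@L2_T2_bounded R _ 0);
      [split; exact: measurable_cst|move=> p; rewrite normr0].
    move=> l; rewrite fourierE; set J := cintegral _ _ _.
    have -> : J = cintegral (leb2 R) (@T2 R) (fun=> 0).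
      by apply: eq_cintegral => p _; exact: mul0r.
    by rewrite cintegral0 mulr0.
  move=> [h [_ [u [[_ /(_ T)] ]]]].
  have TT : `[0, T]%classic T by rewrite /= in_itv/= lexx ltW.
  by move=> /(_ TT)[v [w [F [vE _ _ _]]]] _; apply: nov; exists v.
exists (v0 \+ @lacunary R); split.
  have [[v2 v0E] _] := hv0; split; first exact: L2_T2D v2 (@lacunary_L2 R).
  move=> l; rewrite fourierD ?v0E ?fourier_lacunary0 ?addr0//.
  - exact: L2_cintegrable.
  - exact: L2_cintegrable (@lacunary_L2 R).
move=> [h [hh [u [uh uT]]]].
have M0 : 0 <= M.
  have /gM/andP[] : @T1 R 0 by rewrite /Defs.T1 /= in_itv/= lexx mulr_gt0 ?pi_gt0.
  exact: le_trans.
have qbd := strip_ratio_bound hab0 hab1; have /andP[q0 _] := qbd.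
have gq y : @T1 R y -> 0 < g y ->
    (1 + cos ((a + b) / 2 + pi - y)) / 2 <= (1 - cos ((b - a) / 2)) / 2.
  by move=> _ /g_supp[n]; exact: outside_strip.
apply: (lacunary_contradiction qbd M0 hT _
  (fun m N => reachable_lacunary_le mg gM q0 gq hT m N hv0 hh uh uT)).
apply: mulr_ge0.
  by rewrite mulr_ge0// addr_ge0// !mulr_ge0 ?pi_ge0.
apply: addr_ge0; first by rewrite mulr_ge0 ?sqr_ge0 ?ltW.
rewrite fine_ge0// integral_ge0// => t _.
by apply: integral_ge0 => p _; rewrite lee_fin sqr_ge0.
Qed.
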